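(* Let $T>0$, $a>0$, $N\geq 1$ and $2\leq p<3$. If $f\in \mathcal{C}_b^2(\mathbb{R};\mathcal{L}(\mathbb{R}^N,\mathbb{R}))$ and $\mathbb{X}=(\mathbb{X}^1,\mathbb{X}^2)$ is a geometric $N$-dimensional $p$-variation rough path on $[0,T]$, then the reflected rough differential equation $$d y_t = f(y_t)\, d\mathbb{X}_t + d m_t,\qquad y_t\, d m_t=0,$$ admits at least one solution $(y,m)$ on $[0,T]$ with initial condition $a$ (in the sense defined in the context).
   Context: $f\in\mathcal{C}^2_b$ means that $f$ is $2$-times differentiable, bounded with bounded derivatives (the analogue of the paper's convention for $\mathcal{C}^3_b$). Increments. For a path $g$ on $[0,T]$, $\delta g_{st}:=g_t-g_s$; for a two-index map $g$, $\delta g_{sut}:=g_{st}-g_{su}-g_{ut}$. Controls. For an interval $I$ let $\mathcal{S}_I:=\{(s,t)\in I^2: s\leq t\}$. A control on $I$ is a map $\omega:\mathcal{S}_I\to[0,\infty)$ with $\omega(s,u)+\omega(u,t)\leq\omega(s,t)$ for $s\leq u\leq t$. It is regular if $\lim_{|t-s|\to0}\omega(s,t)=0$. Variation spaces. For $q>0$, a Banach space $E$ and $g:\mathcal{S}_I\to E$, set $\|g\|_{\bar V^q_2(I;E)}:=\sup_{(t_i)}\big(\sum_i|g_{t_it_{i+1}}|^q\big)^{1/q}$, the supremum being over all partitions $(t_i)$ of $I$; $\bar V^q_2(I;E)$ is the set of $g$ for which this is finite, and then $\omega_g(s,t):=\|g\|^q_{\bar V^q_2([s,t];E)}$ is a control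 on $I$. $V^q_2(I;E)$ is the set of $g\in\bar V^q_2(I;E)$ such that $\omega_g$ is regular. $\bar V^q_1(I;E)$ (resp. $V^q_1(I;E)$) is the set of paths $g:I\to E$ such that $\delta g\in\bar V^q_2(I;E)$ (resp. $V^q_2(I;E)$). $V^q_{2,\mathrm{loc}}(I;E)$ is the set of maps $g:\mathcal{S}_I\to E$ for which there is a countable covering $\{I_k\}_k$ of $I$ by intervals with $g\in V^q_2(I_k;E)$ for every $k$. If $E$ is replaced by a subset of a Banach space, the path is required to take values in that subset. Rough paths. A (continuous) $N$-dimensional $p$-variation rough path on $[0,T]$ is a pair $\mathbb{X}=(\mathbb{X}^1,\mathbb{X}^2)\in V^p_2([0,T];\mathbb{R}^N)\times V^{p/2}_2([0,T];\mathbb{R}^{N\times N})$ such that $\delta\mathbb{X}^{1}_{sut}=0$ and $\delta\mathbb{X}^{2;ij}_{sut}=\mathbb{X}^{1,i}_{su}\mathbb{X}^{1,j}_{ut}$ for all $s<u<t$ in $[0,T]$ and $i,j\in\{1,\dots,N\}$. It is geometric if it is the limit, in the $p$-variation topology of $V^p_2\times V^{p/2}_2$, of a sequence of smooth rough paths $\mathbb{X}^\varepsilon=(\mathbb{X}^{\varepsilon,1},\mathbb{X}^{\varepsilon,2})$ given by $\mathbb{X}^{\varepsilon,1,i}_{st}:=\delta x^{\varepsilon,i}_{st}$, $\mathbb{X}^{\varepsilon,2,ij}_{st}:=\int_s^t\delta x^{\varepsilon,i}_{su}\,dx^{\varepsilon,j}_u$ for some smooth path $x^\varepsilon:[0,T]\to\mathbb{R}^N$.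 Solution. Write $f_1,\dots,f_N$ for the components of $f$ and $f_{2,ij}(\xi):=f_i'(\xi)f_j(\xi)$; repeated indices are summed. A pair $(y,m)\in V^p_1([0,T];\mathbb{R}_{\geq0})\times V^1_1([0,T];\mathbb{R}_{\geq0})$ with $m$ increasing (nondecreasing; $m$ is also regarded as a measure with $m([0,t])=m_t$) is a solution on $[0,T]$ with initial condition $a$ if there exists $y^\natural\in V^{p/3}_{2,\mathrm{loc}}([0,T];\mathbb{R})$ such that for all $s\leq t$ in $[0,T]$ $$\delta y_{st}=f_i(y_s)\mathbb{X}^{1,i}_{st}+f_{2,ij}(y_s)\mathbb{X}^{2,ij}_{st}+\delta m_{st}+y^\natural_{st},\qquad y_0=a,\qquad m_t=\int_0^t\mathbf{1}_{\{y_u=0\}}\,dm_u .$$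
   Formalization: The second-order term f_{2,ij}(y_s) X^{2,ij}_{st} is corrected to f_{2,ij}(y_s) X^{2,ji}_{st}: with the stated conventions the original index order makes the claim false for N ≥ 2 (e.g. f = (cos, sin), Brownian Stratonovich lift); for N = 1 they coincide. *)

(* Defs.v *)
From HB Require Import structures.
From mathcomp Require Import all_boot all_order all_algebra.
From mathcomp Require Import all_classical all_reals all_analysis.

Set Implicit Arguments.
Unset Strict Implicit.
Unset Printing Implicit Defensive.

Import Order.TTheory GRing.Theory Num.Theory.
Import numFieldNormedType.Exports.

Local Open Scope classical_set_scope.
Local Open Scope ring_scope.

(* Paths on an interval I and two-index maps on {(s, t) in I^2 | s <= t} are
   total functions on R, R * R; no definition below looks at their values
   elsewhere. *)

Definition incr (R : realType) (E : zmodType) (g : R -> E) (s t : R) : E :=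
  g t - g s.

Definition incr2 (R : realType) (E : zmodType) (g : R -> R -> E)
  (s u t : R) : E := g s t - g s u - g u t.

(* Partition points are strictly increasing, so the diagonal values g t t play
   no role.  The points are not forced to include the endpoints of I, which
   need not belong to I; when they do, adding them only increases the sum. *)
Definition partitions (R : realType) (I : set R) : set (seq R) :=
  [set ts | sorted <%R ts /\ {in ts, forall t, I t}].

Definition var_norm (R : realType) (E : normedModType R) (q : R) (I : set R)
    (g : R -> R -> E) : \bar R :=
  ereal_sup [set (((\sum_(i < (size ts).-1) `|g ts`_i ts`_i.+1| `^ q)
                    `^ q^-1)%:E) | ts in partitions I].

Definition var_control (R : realType) (E : normedModType R) (q : R)
    (g : R -> R -> E) (s t : R) : \bar R :=
  (var_norm q `[s, t] g `^ q)%E.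

Definition regular_control (R : realType) (I : set R) (w : R -> R -> \bar R) :=
  forall eps : R, 0 < eps -> exists2 delta : R, 0 < delta &
    forall s t : R, I s -> I t -> s <= t -> t - s < delta ->
      (w s t < eps%:E)%E.

Definition in_V2 (R : realType) (E : normedModType R) (q : R) (I : set R)
    (g : R -> R -> E) : Prop :=
  (var_norm q I g < +oo)%E /\ regular_control I (var_control q g).

Definition in_V1 (R : realType) (E : normedModType R) (q : R) (I : set R)
    (g : R -> E) : Prop :=
  in_V2 q I (incr g).

Definition in_V2_loc (R : realType) (E : normedModType R) (q : R) (I : set R)
    (g : R -> R -> E) : Prop :=
  exists J : nat -> set R,
    [/\ forall k, is_interval (J k), \bigcup_k J k = I &
        forall k, in_V2 q (J k) g].

(* The second derivative is not required to be continuous. *)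
Definition C2b (R : realType) (E : normedModType R) (f : R -> E) : Prop :=
  [/\ forall x, derivable f x 1,
      forall x, derivable (derive1 f) x 1 &
      exists M : R, forall x, [/\ `|f x| <= M, `|derive1 f x| <= M &
                                  `|derive1n 2 f x| <= M]].

Definition rough_path (R : realType) (N : nat) (p T : R)
    (X1 : R -> R -> 'rV[R]_N) (X2 : R -> R -> 'M[R]_N) : Prop :=
  [/\ in_V2 p `[0, T] X1,
      in_V2 (p / 2) `[0, T] X2 &
      forall s u t : R, 0 <= s -> s < u -> u < t -> t <= T ->
        incr2 X1 s u t = 0 /\
        forall i j : 'I_N, (incr2 X2 s u t) i j = X1 s u 0 i * X1 u t 0 j].

(* A path is smooth on a compact interval when it is the restriction of a
   smooth path defined on the whole line. *)
Definition smooth_path (R : realType) (E : normedModType R) (x : R -> E) :=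
  forall (n : nat) (t : R), derivable (derive1n n x) t 1.

Definition smooth_lift (R : realType) (N : nat) (x : R -> 'rV[R]_N)
    (s t : R) : 'M[R]_N :=
  \matrix_(i, j) \int[lebesgue_measure]_(u in `[s, t])
     (incr x s u 0 i * derive1 (fun v => x v 0 j) u).

Definition geometric_rough_path (R : realType) (N : nat) (p T : R)
    (X1 : R -> R -> 'rV[R]_N) (X2 : R -> R -> 'M[R]_N) : Prop :=
  rough_path p T X1 X2 /\
  exists x : nat -> R -> 'rV[R]_N,
    [/\ forall n, smooth_path (x n),
        (fun n => var_norm p `[0, T]
           (fun s t => incr (x n) s t - X1 s t)) @ \oo --> 0%E &
        (fun n => var_norm (p / 2) `[0, T]
           (fun s t => smooth_lift (x n) s t - X2 s t)) @ \oo --> 0%E].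

(* L(R^N, R) is identified with row vectors, component i of f being
   xi |-> f xi 0 i. *)
Definition f2 (R : realType) (N : nat) (f : R -> 'rV[R]_N) (i j : 'I_N)
    (xi : R) : R :=
  derive1 (fun z => f z 0 i) xi * f xi 0 j.

(* X2 s t i j stands for int_s^t X1 s u 0 i dX1^j_u, so the second-order term
   of the Taylor expansion of int_s^t f_i(y_u) dX1^i_u, namely
   f_i'(y_s) f_j(y_s) int_s^t X1 s u 0 j dX1^i_u, pairs f2 f i j with
   X2 s t j i.  The transposition matters unless f_i' f_j is symmetric in
   (i, j), e.g. when N = 1.

   The measure mu attached to the nondecreasing path m is determined on
   [0, T] by mu [0, t] = m t; it has an atom of mass m 0 at 0. *)
Definition reflected_rde_solution (R : realType) (N : nat) (p T a : R)
    (f : R -> 'rV[R]_N) (X1 : R -> R -> 'rV[R]_N) (X2 : R -> R -> 'M[R]_N)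
    (y m : R -> R) : Prop :=
  [/\ in_V1 p `[0, T] y /\ (forall t, 0 <= t <= T -> 0 <= y t),
      [/\ in_V1 1 `[0, T] m, (forall t, 0 <= t <= T -> 0 <= m t) &
          (forall s t, 0 <= s -> s <= t -> t <= T -> m s <= m t)],
      exists2 ynat : R -> R -> R, in_V2_loc (p / 3) `[0, T] ynat &
        forall s t : R, 0 <= s -> s <= t -> t <= T ->
          incr y s t = \sum_(i < N) f (y s) 0 i * X1 s t 0 i
                       + \sum_(i < N) \sum_(j < N)
                           f2 f i j (y s) * X2 s t j i
                       + incr m s t + ynat s t,
      y 0 = a &
      exists2 mu : {measure set (measurableTypeR R) -> \bar R},
        (forall t, 0 <= t <= T -> mu `[0, t]%classic = (m t)%:E) &
        (forall t, 0 <= t <= T ->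
           (m t)%:E =
             (\int[mu]_(u in `[0%R, t]) (\1_[set v | y v = 0%R] u)%:E)%E)].

(* Main.v *)
Require Import Defs.
From HB Require Import structures.
From mathcomp Require Import all_boot all_order all_algebra.
From mathcomp Require Import all_classical all_reals all_analysis.
From mathcomp Require Import measurable_realfun.
From mathcomp Require Import ring lra.

Import Order.TTheory GRing.Theory Num.Theory.
Import numFieldNormedType.Exports.
Local Open Scope classical_set_scope.
Local Open Scope ring_scope.

(** The solution is a limit of reflected second-order Euler schemes, the limit
being taken over all finite partitions of [0, T] ordered by refinement.

Write G(xi, s, t) = f(xi) X1 s t + f2(xi) X2 s t for the germ of the equation,
and h(s, t) = w(s, t)^(1/p), where w is a control dominating both
|X1|^p and |X2|^(p/2).  Taylor expansion and Chen's relation make the germ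
almost additive along an approximate solution ([germ_estimates]): if x' is
x + G(x, s, u) + e, then G(x, s, t) - G(x, s, u) - G(x', u, t) is of order
h^3 + |e| h.  On a partition, the scheme adds the germ and then projects onto
[0, +oo[, and m records the size of the projections ([scheme_y], [scheme_m]).

The estimate that drives everything ([controlled_small]) is that, wherever h is
small, uniformly in the partition,
  |dy - G - dm| <= K (dm h + h^3)   and   dm <= (2 C + 1) h.
The first bound follows Davie: cut an interval at the grid point where w is
halved; both terms of the right-hand side shrink by a factor lam < 1 when summed
over the two pieces, because dm is additive and comes with the factor h, and
because p < 3 for h^3.  It thus suffices to bound the defect of additivity of
the germ, in which the increments of m occur multiplied by h.  The second bound
is the one-dimensional Skorokhod argument: m stops increasing after the last
visit of y to 0, and at that time y vanishes, so that dm is at most |G| plus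
the remainder, in which dm is multiplied by K h <= 1/2.  The two bounds close up
in an induction on the number of grid points.

These bounds survive pointwise limits along an ultrafilter finer than the
refinements ([reflected_solution]); such limits exist because y and m are
bounded uniformly in the partition.  The limits inherit modulus of continuity h.
Where the limit y is positive, equicontinuity keeps the approximations positive
nearby, so m is locally constant there; covering {y > 0} by countably many
rational intervals shows that the Stieltjes measure of m does not charge it
([contact_measure]).  Since y and m are bounded, the local bounds extend to all
of [0, T], and they say that y has finite p-variation and that the remainder has
finite p/3-variation, with respect to the control dm + w. *)

Set Implicit Arguments.
Unset Strict Implicit.
Unset Printing Implicit Defensive.

(** * Controls and finite variation *)

Section Controls.
Variable R : realType.
Implicit Types (a b s u t q : R) (w : R -> R -> R).

(** Real-valued, so that controls can be added, scaled and raised to powers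
without leaving R; finiteness of the variation makes this possible. *)
Definition control a b w :=
  [/\ forall s t, a <= s -> s <= t -> t <= b -> 0 <= w s t,
      forall s u t, a <= s -> s <= u -> u <= t -> t <= b ->
        w s u + w u t <= w s t &
      regular_control `[a, b] (fun s t => (w s t)%:E)].

Lemma control_mono a b w s s' t' t : control a b w -> a <= s -> s <= s' ->
  s' <= t' -> t' <= t -> t <= b -> w s' t' <= w s t.
Proof.
move=> [w0 wD _] as_ ss st tt tb.
have := wD s s' t as_ ss (le_trans st tt) tb.
have := wD s' t' t (le_trans as_ ss) st tt tb.
have := w0 s s' as_ ss (le_trans st (le_trans tt tb)).
have := w0 t' t (le_trans as_ (le_trans ss st)) tt tb.
lra.
Qed.

Lemma control_diag a b w s : control a b w -> a <= s -> s <= b -> w s s = 0.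
Proof.
move=> [w0 wD _] as_ sb; have := w0 s s as_ (lexx _) sb.
have := wD s s s as_ (lexx _) (lexx _) sb; lra.
Qed.

Lemma controlD a b w w' : control a b w -> control a b w' ->
  control a b (fun s t => w s t + w' s t).
Proof.
move=> [w0 wD wr] [w0' wD' wr']; split.
- by move=> s t *; rewrite addr_ge0// ?w0 ?w0'.
- move=> s u t h1 h2 h3 h4.
  have := wD s u t h1 h2 h3 h4; have := wD' s u t h1 h2 h3 h4; lra.
- move=> e e0; have e2 : 0 < e / 2 by rewrite divr_gt0.
  have [d d0 wd] := wr _ e2; have [d' d0' wd'] := wr' _ e2.
  exists (Num.min d d'); first by rewrite lt_min d0.
  move=> s t Is It st; rewrite lt_min => /andP[/(wd _ _ Is It st) + /(wd' _ _ Is It st)].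
  rewrite !lte_fin; lra.
Qed.

Lemma controlZ a b w c : 0 <= c -> control a b w ->
  control a b (fun s t => c * w s t).
Proof.
move=> c0 [w0 wD wr]; split.
- by move=> s t *; rewrite mulr_ge0// w0.
- by move=> s u t *; rewrite -mulrDr ler_wpM2l// wD.
- move=> e e0; have c1 : 0 < c + 1 by lra.
  have [d d0 wd] := wr _ (divr_gt0 e0 c1).
  exists d => // s t /[dup] Is /= + /[dup] It /=; rewrite !in_itv/=.
  move=> /andP[as_ _] /andP[_ tb] st /(wd _ _ Is It st); rewrite !lte_fin.
  rewrite ltr_pdivlMr//; apply: le_lt_trans; rewrite mulrC.
  by rewrite ler_wpM2l ?w0//; lra.
Qed.

Lemma monotone_control a b (m : R -> R) :
  (forall s t, a <= s -> s <= t -> t <= b -> m s <= m t) ->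
  (forall e, 0 < e -> exists2 d, 0 < d &
     forall s t, a <= s -> s <= t -> t <= b -> t - s < d -> `|m t - m s| <= e) ->
  control a b (fun s t => m t - m s).
Proof.
move=> m_nd mc; split=> [s t as_ st tb|s u t as_ su ut tb|e e0].
- by rewrite subr_ge0 m_nd.
- lra.
- have e2 : 0 < e / 2 by rewrite divr_gt0.
  have [d d0 md] := mc _ e2.
  exists d => // s t; rewrite /= !in_itv/= => /andP[as_ _] /andP[_ tb] st std.
  have := md s t as_ st tb std; have := ler_norm (m t - m s); rewrite lte_fin; lra.
Qed.

Section Variation.
Variables (E : normedModType R) (q : R) (g : R -> R -> E).
Hypothesis q0 : 0 < q.

Definition psum (ts : seq R) : R :=
  \sum_(i < (size ts).-1) `|g ts`_i ts`_i.+1| `^ q.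

Lemma psum_cons2 x y r : psum [:: x, y & r] = `|g x y| `^ q + psum (y :: r).
Proof. by rewrite /psum /= big_ord_recl. Qed.

Lemma psum1 x : psum [:: x] = 0. Proof. by rewrite /psum big_ord0. Qed.
Lemma psum_nil : psum [::] = 0. Proof. by rewrite /psum big_ord0. Qed.

Lemma psum_ge0 ts : 0 <= psum ts.
Proof. by apply: sumr_ge0 => i _; exact: powR_ge0. Qed.

Lemma psum_cat x r1 r2 : psum (rcons r1 x ++ r2) = psum (rcons r1 x) + psum (x :: r2).
Proof.
elim: r1 => [|z r1 IH]; first by rewrite psum1 add0r.
case: r1 IH => [|z' r1] /= IH; first by rewrite !psum_cons2 psum1 addr0.
by rewrite !psum_cons2 IH addrA.
Qed.

Lemma psum_behead x r : psum r <= psum (x :: r).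
Proof.
case: r => [|y r]; first by rewrite psum_nil psum1.
by rewrite psum_cons2 lerDr powR_ge0.
Qed.

Lemma partition_sub (I I' : set R) ts : I `<=` I' -> partitions I ts ->
  partitions I' ts.
Proof. by move=> II [so inI]; split=> // x /inI /II. Qed.

(** When the first partition ends where the second one starts, the common point
must be kept once; otherwise concatenation only adds a nonnegative term. *)
Lemma partition_join s u t ts1 ts2 : s <= u -> u <= t ->
  partitions `[s, u] ts1 -> partitions `[u, t] ts2 ->
  exists2 ts, partitions `[s, t] ts & psum ts1 + psum ts2 <= psum ts.
Proof.
move=> su ut p1 p2.
have {}p1' : partitions `[s, t] ts1.
  by apply: partition_sub p1; apply: subset_itvl; rewrite bnd_simp.
have {}p2' : partitions `[s, t] ts2.
  by apply: partition_sub p2; apply: subset_itvr; rewrite bnd_simp.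
case/lastP: ts1 p1 p1' => [|r1 x] p1 p1'.
  by exists ts2 => //; rewrite psum_nil add0r.
have xu : x <= u.
  have /= := p1.2 x; rewrite mem_rcons mem_head in_itv/= => /(_ isT).
  by case/andP.
have join r2 : path <%R x r2 -> {subset r2 <= ts2} ->
    partitions `[s, t] (rcons r1 x ++ r2).
  move=> pr sub; split.
    by move: p1'.1; case: (r1) => [|z r1'] //= so; rewrite cat_path so last_rcons.
  move=> z; rewrite mem_cat => /orP[|/sub]; [exact: p1'.2|exact: p2'.2].
case: ts2 p2 p2' join => [|y r2] p2 p2' join.
  by exists (rcons r1 x) => //; rewrite psum_nil addr0.
have uy : u <= y by have /= := p2.2 y (mem_head _ _); rewrite in_itv/= => /andP[].
have := le_trans xu uy; rewrite le_eqVlt => /predU1P[xy|xy].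
  exists (rcons r1 x ++ r2); last by rewrite psum_cat xy.
  by apply: join; [rewrite xy; exact: p2.1|move=> z zr; rewrite inE zr orbT].
exists (rcons r1 x ++ y :: r2).
  by apply: join => //=; rewrite xy; exact: p2.1.
by rewrite psum_cat lerD2l psum_behead.
Qed.

Lemma var_norm_ge0 I : (0 <= var_norm q I g)%E.
Proof.
apply: ereal_sup_ubound; exists [::]; first by split.
by rewrite big_ord0 powR0// invr_eq0 gt_eqF.
Qed.

Lemma psum_le_var_norm I ts : partitions I ts ->
  ((psum ts `^ q^-1)%:E <= var_norm q I g)%E.
Proof. by move=> pt; apply: ereal_sup_ubound; exists ts. Qed.

Lemma var_norm_le I c : (forall ts, partitions I ts -> psum ts <= c) ->
  (var_norm q I g <= (c `^ q^-1)%:E)%E.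
Proof.
move=> H; apply: ge_ereal_sup => _ [ts pt <-]; rewrite lee_fin.
have c0 : 0 <= c by apply: le_trans (H [::] _) => //; exact: psum_ge0.
by rewrite ge0_ler_powR ?nnegrE ?psum_ge0 ?invr_ge0 ?(ltW q0)// H.
Qed.

Lemma powR_invK c : 0 <= c -> (c `^ q^-1) `^ q = c.
Proof. by move=> c0; rewrite -powRrM mulVf ?gt_eqF// powRr1. Qed.

Lemma var_norm_subset (I I' : set R) : I `<=` I' ->
  (var_norm q I g <= var_norm q I' g)%E.
Proof.
move=> II; apply: ge_ereal_sup => _ [ts pt <-].
by apply: psum_le_var_norm; exact: partition_sub pt.
Qed.

(** The control is the [q]-th power of the variation norm itself, that is, the
supremum of the sums [psum]; superadditivity is [partition_join]. *)
Lemma in_V2_control a b : in_V2 q `[a, b] g -> exists2 w, control a b w &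
  forall s t, a <= s -> s < t -> t <= b -> `|g s t| `^ q <= w s t.
Proof.
move=> [vfin vreg]; pose w s t := fine (var_control q g s t).
have wE s t : a <= s -> t <= b -> exists2 r, 0 <= r &
    (var_norm q `[s, t] g = r%:E /\ var_control q g s t = (r `^ q)%:E).
  move=> as_ tb.
  have : (var_norm q `[s, t] g < +oo)%E.
    apply: le_lt_trans vfin; apply: var_norm_subset.
    by apply: subset_itv; rewrite bnd_simp.
  have := var_norm_ge0 `[s, t]; rewrite /var_control.
  case: (var_norm q `[s, t] g) => [r| |]//=; rewrite lee_fin => r0 _.
  by exists r => //; rewrite poweR_EFin.
have w_fin s t : a <= s -> t <= b -> (w s t)%:E = var_control q g s t.
  by move=> as_ tb; rewrite /w; have [r _ [_ ->]] := wE s t as_ tb.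
have w_ub s t ts : a <= s -> t <= b -> partitions `[s, t] ts -> psum ts <= w s t.
  move=> as_ tb pt; have [r r0 [vE cE]] := wE s t as_ tb.
  rewrite /w cE /= -[psum ts]powR_invK ?psum_ge0//.
  rewrite ge0_ler_powR ?nnegrE ?powR_ge0 ?(ltW q0)// -lee_fin -vE.
  exact: psum_le_var_norm.
have w_lub s t c : a <= s -> t <= b ->
    (forall ts, partitions `[s, t] ts -> psum ts <= c) -> w s t <= c.
  move=> as_ tb H; have [r r0 [vE cE]] := wE s t as_ tb.
  have c0 : 0 <= c by apply: le_trans (H [::] _) => //; exact: psum_ge0.
  rewrite /w cE /= -[leRHS]powR_invK//.
  by rewrite ge0_ler_powR ?nnegrE ?powR_ge0 ?(ltW q0)// -lee_fin -vE var_norm_le.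
exists w; first split.
- by move=> s t as_ st tb; rewrite -psum_nil; apply: w_ub.
- move=> s u t as_ su ut tb; rewrite -lerBrDr; apply: (w_lub) => //.
    exact: le_trans ut tb.
  move=> ts1 p1; rewrite lerBrDr addrC -lerBrDr; apply: (w_lub) => //.
    exact: le_trans as_ su.
  move=> ts2 p2; rewrite lerBrDr addrC.
  have [ts pt /le_trans] := partition_join su ut p1 p2; apply.
  exact: w_ub.
- move=> e e0; have [d d0 H] := vreg e e0; exists d => // s t Is It st std.
  have /= := Is; have /= := It; rewrite !in_itv/= => /andP[_ tb] /andP[as_ _].
  by rewrite w_fin//; exact: H.
- move=> s t as_ st tb; apply: (@le_trans _ _ (psum [:: s; t])).
    by rewrite psum_cons2 psum1 addr0.
  apply: w_ub => //; split; first by rewrite /= st.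
  by move=> x; rewrite !inE /= in_itv/= => /orP[] /eqP ->; rewrite lexx (ltW st).
Qed.

(** Conversely, superadditivity of [w] bounds every sum over a partition of
[[s, t]] by [w s t]. *)
Lemma control_in_V2 a b w : control a b w ->
  (forall s t, a <= s -> s < t -> t <= b -> `|g s t| `^ q <= w s t) ->
  in_V2 q `[a, b] g.
Proof.
move=> cw gw.
have sum_le s t ts : a <= s -> s <= t -> t <= b -> partitions `[s, t] ts ->
    psum ts <= w s t.
  elim: ts s => [|x ts IH] s as_ st tb pt.
    by rewrite psum_nil; case: cw => w0 _ _; exact: w0.
  have /= := pt.2 x (mem_head _ _); rewrite in_itv/= => /andP[sx xt].
  have ax := le_trans as_ sx.
  case: ts pt IH => [|y ts] pt IH.
    by rewrite psum1; case: cw => w0 _ _; exact: w0.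
  have /= /andP[xy so] := pt.1.
  have py : partitions `[y, t] (y :: ts).
    split=> // z zy; have /= := pt.2 z; rewrite inE zy orbT !in_itv/=.
    move=> /(_ isT)/andP[_ ->]; rewrite andbT.
    move: zy; rewrite inE => /predU1P[-> //|zt].
    by have /allP := order_path_min lt_trans so => /(_ z zt) /ltW.
  have /= := pt.2 y; rewrite inE mem_head orbT in_itv/= => /(_ isT) /andP[sy yt].
  rewrite psum_cons2; apply: le_trans (control_mono cw as_ sx xt (lexx _) tb).
  case: (cw) => _ wD _; apply: le_trans (wD x y t ax (ltW xy) yt tb).
  apply: lerD; first by apply: gw => //; exact: le_trans yt tb.
  by apply: IH => //; exact: le_trans ax (ltW xy).
split.
  have [ab|ba] := leP a b.
    have le_w : forall ts, partitions `[a, b] ts -> psum ts <= w a b.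
      by move=> ts; exact: sum_le.
    exact: le_lt_trans (var_norm_le le_w) (ltry _).
  apply: (@le_lt_trans _ _ ((0:R) `^ q^-1)%:E); last by rewrite ltry.
  apply: var_norm_le => -[|x ts] [_ pt]; first by rewrite psum_nil.
  have /= := pt x (mem_head _ _); rewrite in_itv/= => /andP[/le_trans h /h].
  by rewrite leNgt ba.
move=> e e0; case: (cw) => w0 _ wr; have [d d0 H] := wr e e0.
exists d => // s t Is It st std; apply: le_lt_trans (H s t Is It st std).
have /= := Is; have /= := It; rewrite !in_itv/= => /andP[_ tb] /andP[as_ _].
rewrite -[w s t]powR_invK ?w0// -poweR_EFin.
apply: gt0_ler_poweR; rewrite ?(ltW q0)// ?in_itv /= ?leey ?andbT ?var_norm_ge0//.
  by rewrite lee_fin powR_ge0.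
by apply: var_norm_le => ts; exact: sum_le.
Qed.

End Variation.
End Controls.

(** The modulus attached to a control: a map has finite
[p]-variation as soon as it is dominated by a multiple of [gauge p w]. *)
Definition gauge (R : realType) (p : R) (w : R -> R -> R) (s t : R) : R :=
  w s t `^ p^-1.

Lemma gauge_mono (R : realType) (p a b : R) w s s' t' t : 0 < p -> control a b w ->
  a <= s -> s <= s' -> s' <= t' -> t' <= t -> t <= b ->
  gauge p w s' t' <= gauge p w s t.
Proof.
move=> p0 cw s0 ss st tt tT; have [w0 _ _] := cw.
apply: ge0_ler_powR; rewrite ?invr_ge0 ?(ltW p0)// ?nnegrE.
- apply: w0; [exact: le_trans s0 ss|by []|exact: le_trans tt tT].
- apply: w0 => //; exact: le_trans ss (le_trans st tt).
- exact: control_mono cw s0 ss st tt tT.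
Qed.

Lemma gauge_small (R : realType) (p a b e : R) w : 0 < p -> control a b w ->
  0 < e -> exists2 d, 0 < d &
    forall s t, a <= s -> s <= t -> t <= b -> t - s < d -> gauge p w s t <= e.
Proof.
move=> p0 [w0 _ wr] e0.
have [d d0 H] := wr (e `^ p) (powR_gt0 _ e0); exists d => // s t s0 st tT std.
have := H s t; rewrite /= !in_itv/= s0 tT (le_trans s0 st) (le_trans st tT).
move=> /(_ isT isT st std); rewrite lte_fin => /ltW wle.
rewrite /gauge -[leRHS](_ : (e `^ p) `^ p^-1 = e).
  by apply: ge0_ler_powR; rewrite ?invr_ge0 ?(ltW p0) ?nnegrE ?powR_ge0 ?w0.
by rewrite -powRrM mulfV ?gt_eqF// powRr1// ltW.
Qed.

Lemma gauge_in_V2 (R : realType) (E : normedModType R) (q a b c : R)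
    (g : R -> R -> E) (w : R -> R -> R) : 0 < q -> 0 <= c -> control a b w ->
  (forall s t, a <= s -> s < t -> t <= b -> `|g s t| <= c * gauge q w s t) ->
  in_V2 q `[a, b] g.
Proof.
move=> q0 c0 cw gw; apply: (control_in_V2 q0 (controlZ (powR_ge0 c q) cw)).
move=> s t as_ st tb.
have w0 : 0 <= w s t by have [w0 _ _] := cw; exact: w0 (ltW st) tb.
rewrite -[X in _ * X](powR_invK q0 w0) -powRM ?powR_ge0//.
by apply: ge0_ler_powR; rewrite ?(ltW q0) ?nnegrE ?mulr_ge0 ?powR_ge0// gw.
Qed.

(** Mixed variation: since [p >= 2], the exponent [1 + 1/p] is at least [3/p],
so on a bounded interval the product is again of order [3/p] with respect to
the control [v + w]. *)
Lemma control_mul_gauge (R : realType) (p a b : R) (v w : R -> R -> R) s t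
    (g := gauge p (fun s t => v s t + w s t)) : 2 <= p ->
  control a b v -> control a b w -> a <= s -> s <= t -> t <= b ->
  v s t * gauge p w s t <= g a b `^ (p - 2) * g s t ^+ 3.
Proof.
move=> p2 cv cw as_ st tb; have p0 : 0 < p by lra.
have cc : control a b (fun s t => v s t + w s t) by exact: controlD.
have [v0 _ _] := cv; have [w0 _ _] := cw; have [c0 _ _] := cc.
have g0 s' t' : 0 <= g s' t' by exact: powR_ge0.
have cE : v s t + w s t = g s t `^ (p - 2) * g s t ^+ 2.
  rewrite -powR_mulrn// -powRD; last by rewrite subrK gt_eqF.
  by rewrite subrK /g /gauge -powRrM mulVf ?gt_eqF// powRr1// c0.
rewrite exprSr mulrA ler_pM ?v0 ?powR_ge0//; last first.
  by apply: ge0_ler_powR; rewrite ?invr_ge0 ?(ltW p0)// ?nnegrE ?c0 ?w0// lerDr v0.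
apply: (@le_trans _ _ (v s t + w s t)); first by rewrite lerDl w0.
rewrite cE; apply: ler_wpM2r; first exact: sqr_ge0.
apply: ge0_ler_powR; rewrite ?subr_ge0 ?nnegrE//.
exact: gauge_mono p0 cc _ _ _ _ _.
Qed.

(** A bound that holds at small scale holds at every scale, at the price of a
larger constant, for a quantity that is bounded. *)
Lemma local_to_global (R : realFieldType) (A k l x h : R) n : 0 <= A -> 0 <= k ->
  0 < l -> 0 <= h -> `|x| <= k -> (h <= l -> `|x| <= A * h ^+ n) ->
  `|x| <= (A + k / l ^+ n) * h ^+ n.
Proof.
move=> A0 k0 l0 h0 xk xl; have hn : 0 <= h ^+ n by exact: exprn_ge0.
rewrite mulrDl; have [/xl xh|/ltW lh] := leP h l.
  by apply: (le_trans xh); rewrite lerDl mulr_ge0// divr_ge0// exprn_ge0// ltW.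
apply: (le_trans xk); apply: (@le_trans _ _ (k / l ^+ n * h ^+ n)).
  rewrite -mulrA ler_peMr// mulrC ler_pdivlMr ?exprn_gt0// mul1r.
  by rewrite lerXn2r// nnegrE// ltW.
by rewrite lerDr mulr_ge0.
Qed.

(** * The germ of the equation *)

Section Taylor.
Variable R : realType.

Lemma mx_entry_le m n (A : 'M[R]_(m, n)) i j : `|A i j| <= `|A|.
Proof. by rewrite [leRHS]/Num.norm /= mx_normrE; exact: (le_bigmax _ _ (i, j)). Qed.

Lemma lipschitz_of_derive (g : R -> R) (M : R) : (forall x, derivable g x 1) ->
  (forall x, `|derive1 g x| <= M) -> forall x y, `|g y - g x| <= M * `|y - x|.
Proof.
move=> dg gM; have main x y : x <= y -> `|g y - g x| <= M * `|y - x|.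
  move=> xy; have [||c _ ->] := @MVT_segment R g (derive1 g) x y xy.
  - by move=> z _; rewrite derive1E; exact: derivableP.
  - by apply: derivable_within_continuous => z _.
  - by rewrite normrM ler_wpM2r.
move=> x y; have [|/ltW] := leP x y; first exact: main.
by move=> /main; rewrite distrC [`|y - x|]distrC.
Qed.

Lemma taylor1_remainder (g : R -> R) (M : R) : (forall x, derivable g x 1) ->
  (forall x y, `|derive1 g y - derive1 g x| <= M * `|y - x|) ->
  forall x y, `|g y - g x - derive1 g x * (y - x)| <= M * `|y - x| ^+ 2.
Proof.
move=> dg gM x y.
have [c cxy ->] : exists2 c, `|c - x| <= `|y - x| &
    g y - g x = derive1 g c * (y - x).
  have mvt a b : a <= b ->
      exists2 c, c \in `[a, b] & g b - g a = derive1 g c * (b - a).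
    move=> ab; apply: MVT_segment => //.
    - by move=> z _; rewrite derive1E; exact: derivableP.
    - by apply: derivable_within_continuous => z _.
  have [xy|/ltW yx] := leP x y.
    have [c + ->] := mvt _ _ xy; rewrite in_itv/= => /andP[xc cy]; exists c => //.
    by rewrite !ger0_norm ?subr_ge0// lerD2r.
  have [c + e] := mvt _ _ yx; rewrite in_itv/= => /andP[xc cy]; exists c.
    by rewrite !ler0_norm ?subr_le0// lerN2 lerD2r.
  by rewrite -opprB e; ring.
by rewrite -mulrBl normrM expr2 mulrA ler_wpM2r// (le_trans (gM _ _))// ler_wpM2l//;
  have := le_trans (normr_ge0 _) (gM 0 1); rewrite subr0 normr1 mulr1.
Qed.

(** Everything the estimates need about [f], with a single constant for all
components. *)
Lemma C2b_components N (f : R -> 'rV[R]_N) : C2b f -> exists2 M, 0 <= M &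
  forall i, let g := fun z => f z 0 i in
  [/\ forall x, `|g x| <= M,
      forall x, `|derive1 g x| <= M,
      forall x y, `|g y - g x| <= M * `|y - x|,
      forall x y, `|derive1 g y - derive1 g x| <= M * `|y - x| &
      forall x y, `|g y - g x - derive1 g x * (y - x)| <= M * `|y - x| ^+ 2].
Proof.
move=> [df ddf [M fM]].
have M0 : 0 <= M by have [/(le_trans (normr_ge0 _))] := fM 0.
exists M => // i g.
have comp (F : R -> 'rV[R]_N) x : derivable F x 1 ->
    derive1 (fun z => F z 0 i) x = derive1 F x 0 i.
  by move=> dF; rewrite !derive1E derive_mx// mxE.
have dg x : derivable g x 1 by have /derivable_mxP := df x; exact.
have gE : derive1 g = fun x => derive1 f x 0 i by apply/funext => x; exact: comp.
have ddg x : derivable (derive1 g) x 1.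
  by rewrite gE; have /derivable_mxP := ddf x; exact.
have g0 x : `|g x| <= M by have [h _ _] := fM x; exact: le_trans (mx_entry_le _ _ _) h.
have g1 x : `|derive1 g x| <= M.
  by have [_ h _] := fM x; rewrite gE; exact: le_trans (mx_entry_le _ _ _) h.
have g2 x : `|derive1 (derive1 g) x| <= M.
  by have [_ _ h] := fM x; rewrite gE comp//; exact: le_trans (mx_entry_le _ _ _) h.
have lip1 := lipschitz_of_derive ddg g2.
by split => //; [exact: lipschitz_of_derive|exact: taylor1_remainder].
Qed.

End Taylor.

Section Germ.
Variables (R : realType) (N : nat) (f : R -> 'rV[R]_N).

(** One step of the second-order Euler scheme, as a function of the increments
[x] and [z] of the driver; [z j i] because of the ordering convention of [f2]. *)
Definition germ (xi : R) (x : 'rV[R]_N) (z : 'M[R]_N) : R :=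
  \sum_i (f xi 0 i * x 0 i + \sum_j f2 f i j xi * z j i).

Lemma germE xi x z : germ xi x z = \sum_(i < N) f xi 0 i * x 0 i +
    \sum_(i < N) \sum_(j < N) f2 f i j xi * z j i.
Proof. by rewrite /germ big_split. Qed.

Lemma germ00 xi : germ xi 0 0 = 0.
Proof.
rewrite /germ big1// => i _; rewrite mxE mulr0 add0r big1// => j _.
by rewrite mxE mulr0.
Qed.

Lemma norm_sum_le (F : 'I_N -> R) B : (forall i, `|F i| <= B) ->
  `|\sum_i F i| <= N%:R * B.
Proof.
move=> FB; apply: (le_trans (ler_norm_sum _ _ _)).
apply: (le_trans (ler_sum _ (fun i _ => FB i))).
by rewrite sumr_const card_ord -[B *+ N]mulr_natl.
Qed.

(** The last estimate is the almost additivity of the germ.  By Chen's relation,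
the term [x^T *m x'] contributes [f_i' f_j x_j x'_i], the first-order part of
[(f_i eta - f_i xi) x'_i]; the rest of that difference is either quadratic in
[eta - xi] or carries [e] or [z]. *)
Lemma germ_estimates : C2b f -> exists2 C, 0 <= C & [/\
  forall xi x z, `|germ xi x z| <= C * (`|x| + `|z|),
  (forall xi x z h, 0 <= h -> h <= 1 -> `|x| <= h -> `|z| <= h ^+ 2 ->
     `|germ xi x z| <= C * h) &
  (forall xi eta x z x' z' h, 0 <= h -> h <= 1 ->
     `|x| <= h -> `|z| <= h ^+ 2 -> `|x'| <= h -> `|z'| <= h ^+ 2 ->
     `|eta - xi - germ xi x z| <= 1 ->
     `|germ xi (x + x') (z + z' + x^T *m x') - germ xi x z - germ eta x' z'| <=
       C * (h ^+ 3 + `|eta - xi - germ xi x z| * h))].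
Proof.
move=> /C2b_components[M M0 fM]; set n : R := N%:R.
have n0 : 0 <= n by exact: ler0n.
pose B := n * (M + n * M ^+ 2).
have B0 : 0 <= B by rewrite mulr_ge0// addr_ge0// mulr_ge0// sqr_ge0.
pose A := 2 * B.
have A0 : 0 <= A by rewrite mulr_ge0.
have f2b i j xi : `|f2 f i j xi| <= M ^+ 2.
  have [fb _ _ _ _] := fM j; have [_ dfb _ _ _] := fM i.
  by rewrite /f2 normrM expr2 ler_pM.
have f2lip i j xi eta : `|f2 f i j xi - f2 f i j eta| <= 2 * M ^+ 2 * `|eta - xi|.
  have [fb _ fl _ _] := fM j; have [_ dfb _ dfl _] := fM i.
  rewrite /f2 [X in `|X|](_ : _ =
      derive1 (fun z => f z 0 i) xi * (f xi 0 j - f eta 0 j) +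
      (derive1 (fun z => f z 0 i) xi - derive1 (fun z => f z 0 i) eta) * f eta 0 j);
    last by ring.
  apply: (le_trans (ler_normD _ _)); rewrite !normrM.
  rewrite [leRHS](_ : _ = M * (M * `|eta - xi|) + M * `|eta - xi| * M); last by ring.
  by rewrite lerD// ler_pM// ?[`|eta - _|]distrC.
have entry m (V : 'M[R]_(m, N)) c k l : `|V| <= c -> `|V k l| <= c.
  exact: le_trans (mx_entry_le _ _ _).
have Gn xi x z : `|germ xi x z| <= B * (`|x| + `|z|).
  rewrite -mulrA; apply: norm_sum_le => i; have [fb _ _ _ _] := fM i.
  apply: (@le_trans _ _ (M * `|x| + n * M ^+ 2 * `|z|)); last first.
    rewrite mulrDl mulrDr mulrDr.
    have : 0 <= M * `|z| by rewrite mulr_ge0.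
    have : 0 <= n * M ^+ 2 * `|x| by rewrite !mulr_ge0// sqr_ge0.
    lra.
  apply: (le_trans (ler_normD _ _)); apply: lerD.
    by rewrite normrM ler_pM// entry.
  rewrite -mulrA; apply: norm_sum_le => j.
  by rewrite normrM ler_pM// entry.
have Gb xi x z h : 0 <= h -> h <= 1 -> `|x| <= h -> `|z| <= h ^+ 2 ->
    `|germ xi x z| <= A * h.
  move=> h0 h1 xh zh; apply: (le_trans (Gn xi x z)).
  apply: (@le_trans _ _ (B * (2 * h))); last by rewrite /A mulrCA mulrA.
  apply: ler_wpM2l => //.
  have : h ^+ 2 <= h by rewrite expr2 ler_piMl.
  lra.
pose a := 3 * M + 2 * n * M ^+ 2.
pose b := 2 * M * A ^+ 2 + n ^+ 2 * M ^+ 3 + 2 * n * M ^+ 2 * A.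
have M2 : 0 <= M ^+ 2 by exact: sqr_ge0.
have a0 : 0 <= a by rewrite addr_ge0 ?mulr_ge0.
have b0 : 0 <= b by rewrite !(addr_ge0, mulr_ge0, exprn_ge0).
exists (A + n * (a + b)); first by rewrite addr_ge0// mulr_ge0// addr_ge0.
split=> [xi x z|xi x z h h0 h1 xh zh|].
- apply: (le_trans (Gn xi x z)); rewrite ler_wpM2r ?addr_ge0//.
  have : 0 <= n * (a + b) by rewrite mulr_ge0// addr_ge0.
  rewrite /A; lra.
  apply: le_trans (Gb xi x z h h0 h1 xh zh) _.
  by rewrite ler_wpM2r// lerDl mulr_ge0// addr_ge0.
move=> xi eta x z x' z' h h0 h1 xh zh xh' zh'.
have Gh := Gb xi x z h h0 h1 xh zh.
pose P := \sum_j f xi 0 j * x 0 j.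
pose S := \sum_i \sum_j f2 f i j xi * z j i.
have GE : germ xi x z = P + S by rewrite /germ big_split.
set e := eta - xi - germ xi x z => e1.
have dE : eta - xi = e + germ xi x z by rewrite /e; ring.
have eP : eta - xi - P = e + S by rewrite dE GE; ring.
set d := `|eta - xi|; have d0 : 0 <= d by exact: normr_ge0.
have dle : d <= `|e| + A * h by rewrite /d dE (le_trans (ler_normD _ _))// lerD2l.
have Sb : `|S| <= n * (n * (M ^+ 2 * h ^+ 2)).
  apply: norm_sum_le => i; apply: norm_sum_le => j.
  by rewrite normrM ler_pM// entry.
pose D i := - (f eta 0 i - f xi 0 i - derive1 (fun z => f z 0 i) xi * P) * x' 0 i
  + \sum_j (f2 f i j xi - f2 f i j eta) * z' j i.
have -> : germ xi (x + x') (z + z' + x^T *m x') - germ xi x z - germ eta x' z' =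
    \sum_i D i.
  rewrite /germ -!sumrB; apply: eq_bigr => i _.
  have -> : \sum_j f2 f i j xi * (z + z' + x^T *m x') j i =
     \sum_j f2 f i j xi * z j i + \sum_j f2 f i j xi * z' j i +
     derive1 (fun z => f z 0 i) xi * P * x' 0 i.
    rewrite mulr_sumr mulr_suml -!big_split; apply: eq_bigr => j _ /=.
    by rewrite !mxE big_ord1 !mxE /f2; ring.
  rewrite /D; under [X in _ = _ + X]eq_bigr do rewrite mulrBl.
  by rewrite sumrB mxE; ring.
have e0 : 0 <= `|e| by [].
set E := h ^+ 3 + _.
have E0 : 0 <= E by rewrite addr_ge0 ?mulr_ge0 ?exprn_ge0.
apply: (@le_trans _ _ (n * ((a + b) * E))); last first.
  by rewrite mulrA ler_wpM2r// lerDr.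
apply: norm_sum_le => i; have [fb dfb fl dfl ft] := fM i.
apply: (le_trans (ler_normD _ _)).
apply: (@le_trans _ _ ((M * d ^+ 2 + M * (`|e| + n * (n * (M ^+ 2 * h ^+ 2)))) * h +
    n * (2 * M ^+ 2 * d * h ^+ 2))).
  apply: lerD; last first.
    by apply: norm_sum_le => j; rewrite normrM ler_pM// entry.
  rewrite normrM normrN ler_pM//; last exact: entry.
  have -> : f eta 0 i - f xi 0 i - derive1 (fun z => f z 0 i) xi * P =
     (f eta 0 i - f xi 0 i - derive1 (fun z => f z 0 i) xi * (eta - xi)) +
     derive1 (fun z => f z 0 i) xi * (eta - xi - P) by ring.
  apply: (le_trans (ler_normD _ _)); rewrite lerD// eP normrM ler_pM//.
  by rewrite (le_trans (ler_normD _ _))// lerD2l.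
have d2 : d ^+ 2 <= 2 * `|e| + 2 * (A * h) ^+ 2.
  apply: (@le_trans _ _ ((`|e| + A * h) ^+ 2)).
    by rewrite lerXn2r// nnegrE// addr_ge0// mulr_ge0.
  have : `|e| ^+ 2 <= `|e| by rewrite expr2 ler_piMl.
  have := sqr_ge0 (`|e| - A * h); rewrite !sqrrD sqrrN mulrN mulNrn.
  lra.
have t1 : M * d ^+ 2 * h <= M * (2 * `|e| + 2 * (A * h) ^+ 2) * h.
  by rewrite ler_wpM2r// ler_wpM2l.
have t2 : n * (2 * M ^+ 2 * d * h ^+ 2) <= n * (2 * M ^+ 2 * (`|e| + A * h) * h ^+ 2).
  rewrite ler_wpM2l// ler_wpM2r ?sqr_ge0// ler_wpM2l// mulr_ge0//.
have t3 : n * (2 * M ^+ 2 * `|e| * h ^+ 2) <= n * (2 * M ^+ 2 * `|e| * h).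
  rewrite ler_wpM2l// ler_wpM2l ?mulr_ge0// expr2 ler_piMl//.
rewrite [leLHS](_ : _ = M * d ^+ 2 * h + n * (2 * M ^+ 2 * d * h ^+ 2) +
   (M * (`|e| + n * (n * (M ^+ 2 * h ^+ 2)))) * h); last by ring.
apply: (@le_trans _ _ (a * (`|e| * h) + b * h ^+ 3)); last first.
  have : 0 <= a * h ^+ 3 by rewrite mulr_ge0// exprn_ge0.
  have : 0 <= b * (`|e| * h) by rewrite mulr_ge0// mulr_ge0.
  rewrite /E; lra.
rewrite /a /b; lra.
Qed.

Lemma germ_continuous x z : C2b f -> continuous (fun xi => germ xi x z).
Proof.
move=> [df ddf _].
have fc i : continuous (fun xi => f xi 0 i).
  move=> xi; apply/differentiable_continuous/derivable1_diffP.
  by have /derivable_mxP := df xi; exact.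
have dfc i : continuous (derive1 (fun xi => f xi 0 i)).
  move=> xi; apply/differentiable_continuous/derivable1_diffP.
  have -> : derive1 (fun xi => f xi 0 i) = fun xi => derive1 f xi 0 i.
    by apply/funext => eta; rewrite !derive1E derive_mx// mxE.
  by have /derivable_mxP := ddf xi; exact.
have sumc (F : 'I_N -> R -> R) :
    (forall i, continuous (F i)) -> continuous (fun xi => \sum_i F i xi).
  by move=> Fc; apply: continuous_big => //; exact: add_continuous.
apply: (sumc) => i xi; apply: cvgD.
  by apply: cvgMl; exact: fc.
apply: (sumc (fun j xi => f2 f i j xi * z j i)) => j {}xi.
by apply: cvgMl; apply: cvgM; [exact: dfc|exact: fc].
Qed.

End Germ.

(** * The discrete reflected scheme *)

Definition remainder {R : zmodType} {T : Type} (G : R -> T -> T -> R)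
    (y m : T -> R) (s t : T) : R :=
  y t - y s - G (y s) s t - (m t - m s).

(** A priori bounds for any discrete reflected path.  [rho] is the factor by which
[h] shrinks when the interval is halved, so that a bound [K] over the two halves
becomes [lam * K] over the whole, and joining them costs [4 * C]; [L] is the
scale below which [h] counts as small. *)
Section DiscreteReflection.
Variables (R : realFieldType) (G : R -> nat -> nat -> R) (h : nat -> nat -> R).
Variables (y m : nat -> R) (C rho lam K L : R).
Local Notation J := (remainder G y m).

Hypothesis h_ge0 : forall i j, 0 <= h i j.
Hypothesis h_mono : forall i i' j' j, (i <= i')%N -> (i' <= j')%N ->
  (j' <= j)%N -> h i' j' <= h i j.
Hypothesis h_split : forall i j, (i < j)%N -> exists l,
  [/\ (i <= l)%N, (l < j)%N, h i l <= rho * h i j & h l.+1 j <= rho * h i j].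
Hypothesis G_diag : forall x i, G x i i = 0.
Hypothesis G_bound : forall x i j, (i <= j)%N -> h i j <= 1 ->
  `|G x i j| <= C * h i j.
Hypothesis G_almost_additive : forall x x' i u j, (i <= u)%N -> (u <= j)%N ->
  h i j <= 1 -> `|x' - x - G x i u| <= 1 ->
  `|G x i j - G x i u - G x' u j| <=
     C * (h i j ^+ 3 + `|x' - x - G x i u| * h i j).

Hypothesis y_ge0 : forall k, 0 <= y k.
Hypothesis m_incr : forall k, m k <= m k.+1.
Hypothesis step : forall k, J k k.+1 = 0.
Hypothesis contact : forall k, m k < m k.+1 -> y k.+1 = 0.

Hypothesis C_ge0 : 0 <= C.
Hypothesis rho_ge0 : 0 <= rho.
Hypothesis rho_lam : rho <= lam.
Hypothesis rho3_lam : 2 * rho ^+ 3 <= lam.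
Hypothesis K_fix : lam * K + 4 * C <= K.
Hypothesis K_ge0 : 0 <= K.
Hypothesis KL : K * L <= 1 / 2.
Hypothesis CL : (2 * C + 1) * L <= 1 / 4.
Hypothesis L_small : L <= 1 / 4.

Lemma m_mono : {homo m : i j / (i <= j)%N >-> i <= j}.
Proof. exact: (homo_leq lexx le_trans). Qed.

Definition controlled i j :=
  `|J i j| <= K * ((m j - m i) * h i j + h i j ^+ 3) /\
  m j - m i <= (2 * C + 1) * h i j.

Lemma slope_ge0 : 0 <= 2 * C + 1.
Proof. by rewrite addr_ge0 // mulr_ge0. Qed.

Lemma J_diag i : J i i = 0.
Proof. by rewrite /remainder G_diag !subrr. Qed.

Lemma controlled_diag i : controlled i i.
Proof.
rewrite /controlled J_diag subrr normr0 mul0r add0r; have h0 := h_ge0 i i.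
split; apply: mulr_ge0 => //; last exact: slope_ge0.
exact: exprn_ge0.
Qed.

(** Here [e = dm + J] measures how far the step from [i] to [u] is from the germ;
the smallness of [h] absorbs the constant [K] of the bound on [J], so that the
constant [2 C] does not involve [K].  This is what makes it possible to choose
[K] afterwards. *)
Lemma defect_bound i u t j : (i <= u)%N -> (u <= t)%N -> (t <= j)%N ->
  h i j <= L -> controlled i u ->
  `|J i t - J i u - J u t| <=
     2 * C * ((m j - m i) * h i j + h i j ^+ 3).
Proof.
move=> iu ut tj hL [Jiu miu].
have uj := leq_trans ut tj; have ij := leq_trans iu uj.
have hh : h i u <= h i j by exact: h_mono.
have hh' : h i t <= h i j by apply: h_mono => //; exact: leq_trans iu ut.
have H0 := h_ge0 i j; have h0 := h_ge0 i u; have h0' := h_ge0 i t.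
have mu0 : 0 <= m u - m i by rewrite subr_ge0; exact: m_mono.
have muj : m u - m i <= m j - m i by rewrite lerD2r; exact: m_mono.
have eE : y u - y i - G (y i) i u = (m u - m i) + J i u by rewrite /remainder; ring.
set e := y u - y i - G (y i) i u in eE *.
set D' := m u - m i in mu0 muj miu Jiu eE; set D := m j - m i in muj *.
set H := h i j in H0 hL hh hh' *; set k := h i u in hh h0 miu Jiu *.
have Kk : K * k <= 1 / 2.
  by apply: le_trans KL; apply: ler_wpM2l => //; apply: le_trans hL.
have J2 : `|J i u| <= 1 / 2 * (D' + k ^+ 2).
  apply: (le_trans Jiu); rewrite [leLHS](_ : _ = K * k * (D' + k ^+ 2)); last by ring.
  apply: ler_wpM2r => //; apply: addr_ge0 => //; exact: sqr_ge0.
have k2 : k ^+ 2 <= H ^+ 2 by rewrite lerXn2r // nnegrE.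
have eb : `|e| <= 2 * D' + H ^+ 2.
  rewrite eE; apply: (le_trans (ler_normD _ _)); rewrite (ger0_norm mu0).
  have := sqr_ge0 H; lra.
have C1 : (2 * C + 1) * k <= 1 / 4.
  apply: le_trans CL; apply: ler_wpM2l; first exact: slope_ge0.
  exact: le_trans hL.
have L1 := L_small.
have H2 : H ^+ 2 <= 1 / 4.
  have : H ^+ 2 <= H * 1 by rewrite expr2; apply: ler_wpM2l => //; lra.
  lra.
have e1 : `|e| <= 1 by lra.
have -> : J i t - J i u - J u t = - (G (y i) i t - G (y i) i u - G (y u) u t).
  by rewrite /remainder; ring.
rewrite normrN; apply: (le_trans (G_almost_additive iu ut _ e1)).
  lra.
rewrite -/e [2 * C]mulrC -mulrA; apply: ler_wpM2l => //.
have h3 : h i t ^+ 3 <= H ^+ 3 by rewrite lerXn2r // nnegrE.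
have : `|e| * h i t <= (2 * D' + H ^+ 2) * H.
  by apply: ler_pM.
have : D' * H <= D * H by apply: ler_wpM2r.
have -> : (2 * D' + H ^+ 2) * H = 2 * (D' * H) + H ^+ 3 by ring.
lra.
Qed.

(** Induction on the number of grid points.  The remainder is bounded by halving
the interval ([h_split]), where [J] vanishes on the middle step; then [m] is
bounded by the Skorokhod argument, which uses the bound just obtained for [J]. *)
Lemma controlled_small i j : (i <= j)%N -> h i j <= L -> controlled i j.
Proof.
move: {2}(j - i)%N (leqnn (j - i)) => d.
elim: d i j => [|d IH] i j dd ij hL.
  suff -> : j = i by exact: controlled_diag.
  by apply/eqP; rewrite eqn_leq ij andbT -subn_eq0 -leqn0.
have [<-|ij'] := eqVneq i j; first exact: controlled_diag.
have {}ij' : (i < j)%N by rewrite ltn_neqAle ij'.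
have sub i' j' : (i <= i')%N -> (i' <= j')%N -> (j' <= j)%N ->
    (j' - i' < j - i)%N -> controlled i' j'.
  move=> ii jj jj' lt; apply: IH => //; first exact: leq_trans lt dd.
  by apply: le_trans hL; apply: h_mono.
have c0 := C_ge0; have L1 := L_small.
set H := h i j in hL *; set D := m j - m i.
have H0 : 0 <= H by exact: h_ge0.
have D0 : 0 <= D by rewrite subr_ge0; exact: m_mono.
set B := D * H + H ^+ 3.
have B0 : 0 <= B by apply: addr_ge0; [exact: mulr_ge0|exact: exprn_ge0].
have half : `|J i j| <= K * B.
  have [l [il lj]] := h_split ij'; rewrite -/H => hl hl'.
  have [gJ1 _] : controlled i l by apply: sub (leqnn _) il (ltnW lj) _; exact: ltn_sub2r.
  have [gJ2 _] : controlled l.+1 j.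
    by apply: sub (leqW il) lj (leqnn _) _; exact: ltn_sub2l.
  have h1 := h_ge0 i l; have h2 := h_ge0 l.+1 j.
  have m1 : 0 <= m l - m i by rewrite subr_ge0; exact: m_mono.
  have m2 : 0 <= m j - m l.+1 by rewrite subr_ge0; exact: m_mono.
  have m3 := m_incr l.
  have JJ : `|J i l| + `|J l.+1 j| <= lam * K * B.
    apply: (le_trans (lerD gJ1 gJ2)); rewrite -mulrDr [lam * K]mulrC -mulrA.
    apply: ler_wpM2l => //.
    have c1 : h i l ^+ 3 <= (rho * H) ^+ 3.
      by rewrite lerXn2r // nnegrE mulr_ge0.
    have c2 : h l.+1 j ^+ 3 <= (rho * H) ^+ 3.
      by rewrite lerXn2r // nnegrE mulr_ge0.
    have b1 := ler_wpM2l m1 hl; have b2 := ler_wpM2l m2 hl'.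
    have b3 : (m l - m i) * (rho * H) + (m j - m l.+1) * (rho * H) <= lam * (D * H).
      rewrite -mulrDl; apply: (@le_trans _ _ (D * (rho * H))).
        by apply: ler_wpM2r; [exact: mulr_ge0|rewrite /D; lra].
      by rewrite mulrCA; apply: ler_wpM2r; [exact: mulr_ge0|].
    have b4 : (rho * H) ^+ 3 + (rho * H) ^+ 3 <= lam * H ^+ 3.
      rewrite exprMn -mulr2n -mulrnAl -[rho ^+ 3 *+ 2]mulr_natl.
      by apply: ler_wpM2r => //; exact: exprn_ge0.
    rewrite /B mulrDr; lra.
  have d1 : `|J i j - J i l - J l.+1 j| <= 4 * C * B.
    have [lj1|lj1] := eqVneq l.+1 j.
      have /(@defect_bound i l j j il (ltnW lj) (leqnn _) hL) : controlled i l.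
        by apply: sub => //; [exact: ltnW|exact: ltn_sub2r].
      have -> : J l j = J l.+1 j by rewrite -lj1 step J_diag.
      move=> /le_trans; apply; rewrite -/H -/D -/B.
      by apply: ler_wpM2r => //; lra.
    have := @defect_bound i l l.+1 j il (leqnSn _) lj hL.
    have := @defect_bound i l.+1 j j (leqW il) lj (leqnn _) hL.
    rewrite step subr0 -/H -/D -/B => e1 e2.
    rewrite (_ : J i j - _ - _ = (J i j - J i l.+1 - J l.+1 j) + (J i l.+1 - J i l)); last by ring.
    apply: (le_trans (ler_normD _ _)).
    rewrite [4 * C * B](_ : _ = 2 * C * B + 2 * C * B); last by ring.
    have lj2 : (l.+1 < j)%N by rewrite ltn_neqAle lj1.
    apply: lerD; [apply: e1|apply: e2]; apply: sub => //.
    - exact: leqW.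
    - exact: ltn_sub2r.
    - exact: ltnW.
    - exact: ltn_sub2r.
  rewrite (_ : J i j = J i l + J l.+1 j + (J i j - J i l - J l.+1 j)); last by ring.
  apply: (le_trans (ler_normD _ _)); apply: (le_trans (lerD (ler_normD _ _) (lexx _))).
  have := ler_wpM2r B0 K_fix; rewrite mulrDl; lra.
split=> //; rewrite -/H -/D.
have KH : K * H <= 1 / 2 by apply: le_trans KL; apply: ler_wpM2l.
have [j' jE] : exists j', j = j'.+1.
  by exists j.-1; rewrite prednK // (leq_ltn_trans _ ij').
have lt_j'j : (j' < j)%N by rewrite jE.
have le_ij' : (i <= j')%N by rewrite -ltnS -jE.
have : m j' <= m j by rewrite jE.
have cj : m j' < m j -> y j = 0 by rewrite jE; exact: contact.
rewrite le_eqVlt => /predU1P[mE|/cj y0].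
  have [_ g] : controlled i j' by apply: sub => //; [exact: ltnW|exact: ltn_sub2r].
  rewrite /D -mE; apply: (le_trans g); apply: ler_wpM2l; first exact: slope_ge0.
  by apply: h_mono => //; exact: ltnW.
(* [y] vanishes at [j]: what was pushed is what the unreflected path lost. *)
have DE : D = - y i - G (y i) i j - J i j by rewrite /D /remainder y0; ring.
have Gb : `|G (y i) i j| <= C * H by apply: G_bound => //; rewrite -/H; lra.
have KB : K * B <= 1 / 2 * (D + H ^+ 2).
  rewrite (_ : K * B = K * H * (D + H ^+ 2)); last by rewrite /B; ring.
  by apply: ler_wpM2r => //; apply: addr_ge0 => //; exact: sqr_ge0.
have H2 : H ^+ 2 <= H.
  by rewrite expr2; rewrite -[leRHS]mulr1; apply: ler_wpM2l => //; lra.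
have := y_ge0 i.
have := lerNnormlW Gb; have := lerNnormlW half.
lra.
Qed.

End DiscreteReflection.

Section Scheme.
Variables (R : realFieldType) (G : R -> nat -> nat -> R) (a : R).

Fixpoint scheme_y k : R :=
  if k is j.+1 then Num.max (scheme_y j + G (scheme_y j) j j.+1) 0 else a.

Fixpoint scheme_m k : R :=
  if k is j.+1 then scheme_m j + Num.max (- (scheme_y j + G (scheme_y j) j j.+1)) 0
  else 0.

Lemma scheme_y_ge0 k : 0 <= a -> 0 <= scheme_y k.
Proof. by case: k => [|k] //= _; rewrite le_max lexx orbT. Qed.

Lemma scheme_m_incr k : scheme_m k <= scheme_m k.+1.
Proof. by rewrite /= lerDl le_max lexx orbT. Qed.

Lemma scheme_m_mono : {homo scheme_m : i j / (i <= j)%N >-> i <= j}.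
Proof. exact: (homo_leq lexx le_trans scheme_m_incr). Qed.

Lemma scheme_step k : remainder G scheme_y scheme_m k k.+1 = 0.
Proof.
rewrite /remainder /=; set z := scheme_y k + _.
have -> : G (scheme_y k) k k.+1 = z - scheme_y k by rewrite /z; ring.
rewrite /Num.max oppr_lt0; case: ltgtP => [_|_|->]; ring.
Qed.

Lemma scheme_contact k : scheme_m k < scheme_m k.+1 -> scheme_y k.+1 = 0.
Proof.
rewrite /= ltrDl lt_max ltxx orbF oppr_gt0 => z0.
by apply/max_idPr/ltW.
Qed.

End Scheme.

(** * Limits along refinements of partitions *)

(** Compactness provides a cluster point, and an ultrafilter converges to each of
its cluster points. *)
Lemma ultra_bounded_cvg (R : realType) (T : Type) (U : set_system T)
    (f : T -> R) (b c : R) : UltraFilter U ->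
  U [set x | f x \in `[b, c]] -> cvg (f @ U).
Proof.
move=> UU Ub; have FU := ultra_proper.
have [] := @segment_compact R b c (f @ U) _; first by [].
move=> l [_ lcl]; apply/cvg_ex; exists l => V /= lV.
have [//|UV] := in_ultra_setVsetC (f @^-1` V) UU.
by have [x [/= nVx Vx]] := lcl (~` V) V UV lV.
Qed.

(** The filter of properties that hold for all sufficiently rich lists of points.
A fixed point eventually belongs to the grid, hence the estimates at grid points
pass to the limit at every time, with no interpolation. *)
Definition refinement (T : eqType) : set_system (seq T) :=
  [set A : set (seq T) | exists s : seq T, [set s' : seq T | {subset s <= s'}] `<=` A].

Lemma refinement_filter (T : eqType) : ProperFilter (@refinement T).
Proof.
split; first by move=> [s /(_ s)]; apply.
split; first by exists [::].
- move=> A B [s sA] [s' sB]; exists (s ++ s') => r sub; split.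
    by apply: sA => x xs; apply: sub; rewrite mem_cat xs.
  by apply: sB => x xs; apply: sub; rewrite mem_cat xs orbT.
- by move=> A B AB [s sA]; exists s => r /sA /AB.
Qed.

Lemma refinement_mem (T : eqType) (x : T) : refinement [set s : seq T | x \in s].
Proof. by exists [:: x] => s /(_ x (mem_head _ _)). Qed.

(** Halving the control multiplies [gauge] by this root; the sum of the cubes over
two halves is smaller than the cube over the whole because [3 / p > 1]. *)
Lemma half_powR_cube (R : realType) (p : R) : 0 < p < 3 -> 2 * ((2^-1) `^ p^-1) ^+ 3 < 1.
Proof.
move=> /andP[p0 p3]; set r : R := (2^-1) `^ p^-1.
have one x : (1 : R) `^ x = 1 by rewrite powR1.
have r0 : 0 < r by rewrite powR_gt0.
have rp : r `^ p = 2^-1 by rewrite -powRrM mulVf ?gt_eqF// powRr1.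
have r1 : r < 1.
  rewrite -[ltRHS](one p^-1); apply: gt0_ltr_powR; rewrite ?invr_gt0 ?nnegrE//.
  by rewrite invf_lt1// ltr1n.
have -> : r ^+ 3 = r `^ p * r `^ (3 - p).
  rewrite -powRD; first by rewrite subrKC powR_mulrn// ltW.
  by rewrite (gt_eqF r0) implybT.
rewrite rp mulrA divff// mul1r -[ltRHS](one (3 - p)).
by apply: gt0_ltr_powR; rewrite ?subr_gt0 ?nnegrE// ltW.
Qed.

Section Reflected.
Variables (R : realType) (T C p a : R) (w : R -> R -> R) (G : R -> R -> R -> R).
Hypothesis T_ge0 : 0 <= T.
Hypothesis C_ge0 : 0 <= C.
Hypothesis a_ge0 : 0 <= a.
Hypothesis p_gt0 : 0 < p.
Hypothesis p_lt3 : p < 3.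
Hypothesis w_control : control 0 T w.
Local Notation h := (gauge p w).
Hypothesis G_diag : forall x t, G x t t = 0.
Hypothesis G_bound : forall x s t, 0 <= s -> s <= t -> t <= T -> h s t <= 1 ->
  `|G x s t| <= C * h s t.
Hypothesis G_almost_additive : forall x x' s u t,
  0 <= s -> s <= u -> u <= t -> t <= T ->
  h s t <= 1 -> `|x' - x - G x s u| <= 1 ->
  `|G x s t - G x s u - G x' u t| <=
     C * (h s t ^+ 3 + `|x' - x - G x s u| * h s t).
Hypothesis G_cont : forall s t, continuous (fun x => G x s t).

(* [K] solves [lam * K + 4 * C = K], and [L] makes [h] absorb the constants of
   the a priori bounds. *)
Let rho : R := 2^-1 `^ p^-1.
Let lam := Num.max rho (2 * rho ^+ 3).
Let K := 4 * C / (1 - lam).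
Let L := Num.min (1 / 4) (Num.min (1 / (2 * (K + 1))) (1 / (4 * (2 * C + 1)))).

Let rho_ge0 : 0 <= rho. Proof. exact: powR_ge0. Qed.

Let lam_lt1 : lam < 1.
Proof.
rewrite gt_max half_powR_cube ?p_gt0// andbT.
rewrite -[ltRHS](_ : (1 : R) `^ p^-1 = 1); last by rewrite powR1.
apply: gt0_ltr_powR; rewrite ?invr_gt0 ?nnegrE//.
by rewrite invf_lt1// ltr1n.
Qed.

Let K_ge0 : 0 <= K.
Proof. by rewrite divr_ge0 ?mulr_ge0// subr_ge0 ltW. Qed.

Let K_fix : lam * K + 4 * C <= K.
Proof.
have l1 : 1 - lam != 0 by rewrite subr_eq0 eq_sym lt_eqF.
have : K * (1 - lam) = 4 * C by rewrite divfK.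
lra.
Qed.

Let slope_gt0 : 0 < 2 * C + 1.
Proof. by rewrite ltr_wpDl// mulr_ge0. Qed.

Let L_gt0 : 0 < L.
Proof.
have k0 := K_ge0; have s0 := slope_gt0.
rewrite !lt_min !divr_gt0 ?mulr_gt0//; lra.
Qed.

Let KL : K * L <= 1 / 2.
Proof.
have k0 := K_ge0; have k1 : 0 < K + 1 by lra.
have : L <= 1 / (2 * (K + 1)) by rewrite !ge_min lexx !orbT.
rewrite ler_pdivlMr ?mulr_gt0// => H; have l0 := L_gt0; lra.
Qed.

Let CL : (2 * C + 1) * L <= 1 / 4.
Proof.
have s0 := slope_gt0; have : L <= 1 / (4 * (2 * C + 1)) by rewrite !ge_min lexx !orbT.
rewrite ler_pdivlMr ?mulr_gt0//; lra.
Qed.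

Let L_small : L <= 1 / 4.
Proof. by rewrite ge_min lexx. Qed.

Let h_ge0 s t : 0 <= h s t. Proof. exact: powR_ge0. Qed.

Let h_mono s s' t' t : 0 <= s -> s <= s' -> s' <= t' -> t' <= t -> t <= T ->
  h s' t' <= h s t.
Proof. exact: gauge_mono. Qed.

(** 0 is added as the starting time; the default value [T] makes [tau] monotone on
all of [nat], past the end of the grid. *)
Definition grid (s : seq R) :=
  sort <=%R (undup (0 :: [seq t <- s | t \in `[0, T]])).
Definition tau s k := nth T (grid s) k.

Lemma mem_grid s t : (t \in grid s) = (t == 0) || (t \in s) && (t \in `[0, T]).
Proof. by rewrite mem_sort mem_undup inE mem_filter andbC. Qed.

Lemma grid_uniq s : uniq (grid s).
Proof. by rewrite sort_uniq undup_uniq. Qed.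

Lemma grid_sorted s : sorted <=%R (grid s).
Proof. exact/sort_sorted/le_total. Qed.

Lemma tau_itv s k : 0 <= tau s k <= T.
Proof.
rewrite /tau; case: (ltnP k (size (grid s))) => [/(mem_nth T)|ks]; last first.
  by rewrite nth_default// T_ge0 lexx.
by rewrite mem_grid in_itv/= => /orP[/eqP ->|/andP[]//]; rewrite lexx.
Qed.

Lemma tau_mono s i j : (i <= j)%N -> tau s i <= tau s j.
Proof.
move=> ij; rewrite {2}/tau; case: (ltnP j (size (grid s))) => js; last first.
  by rewrite nth_default//; have /andP[] := tau_itv s i.
by apply: (sorted_leq_nth le_trans (@lexx _ _) T (grid_sorted s)) => //;
  rewrite inE; exact: leq_ltn_trans js.
Qed.

Lemma tau_index s t : t \in grid s -> tau s (index t (grid s)) = t.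
Proof. by move=> ts; exact: nth_index. Qed.

Lemma index_grid_mono s t t' : t \in grid s -> t' \in grid s -> t <= t' ->
  (index t (grid s) <= index t' (grid s))%N.
Proof.
move=> ts ts' tt'; rewrite leqNgt; apply/negP => lt.
have := tau_mono s (ltnW lt); rewrite !tau_index// => t't.
have tE : t = t' by apply/eqP; rewrite eq_le tt' t't.
by rewrite tE ltnn in lt.
Qed.

Lemma zero_grid s : 0 \in grid s. Proof. by rewrite mem_grid eqxx. Qed.

Lemma index_zero_grid s : index 0 (grid s) = 0%N.
Proof.
apply/eqP; rewrite -leqn0 leqNgt; apply/negP => lt.
have z0 := tau_mono s (leq0n (index 0 (grid s))).
rewrite tau_index ?zero_grid// in z0.
have sz : (0 < size (grid s))%N by case: (grid s) (zero_grid s).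
have : tau s 0 = 0 by apply/eqP; rewrite eq_le z0; have /andP[] := tau_itv s 0.
move=> e; have := index_uniq T sz (grid_uniq s); rewrite -/(tau s 0) e => e0.
by rewrite e0 in lt.
Qed.

Definition grid_germ s (x : R) i j := G x (tau s i) (tau s j).
Definition grid_gauge s i j := h (tau s i) (tau s j).
Definition grid_y s := scheme_y (grid_germ s) a.
Definition grid_m s := scheme_m (grid_germ s) a.

(** [l.+1] is the first grid point at which more than half of the control has been
spent, or the last point [j]; superadditivity leaves less than half after it. *)
Lemma control_halving s i j : (i < j)%N -> exists l,
  [/\ (i <= l)%N, (l < j)%N, grid_gauge s i l <= rho * grid_gauge s i j &
      grid_gauge s l.+1 j <= rho * grid_gauge s i j].
Proof.
move=> ij; have [w0 wD _] := w_control.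
have ti k : 0 <= tau s k by have /andP[] := tau_itv s k.
have tT k : tau s k <= T by have /andP[] := tau_itv s k.
pose W k l := w (tau s k) (tau s l).
have W0 k l : (k <= l)%N -> 0 <= W k l by move=> kl; apply: w0 => //; exact: tau_mono.
have Wd k : W k k = 0 by exact: control_diag w_control _ _.
pose P k := (i < k)%N && ((k == j) || (W i j / 2 < W i k)).
have exP : exists k, P k by exists j; rewrite /P ij eqxx.
have [k /andP[ik Pk] kmin] := ex_minnP exP.
have kj : (k <= j)%N by apply: kmin; rewrite /P ij eqxx.
have Wij := W0 _ _ (ltnW ij).
have toh k1 k2 : (k1 <= k2)%N -> W k1 k2 <= W i j / 2 ->
    grid_gauge s k1 k2 <= rho * grid_gauge s i j.
  move=> k12 Wk; rewrite /grid_gauge /gauge mulrC -powRM// ?W0 ?ltnW//.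
  by apply: ge0_ler_powR; rewrite ?invr_ge0 ?(ltW p_gt0)// ?nnegrE ?W0// divr_ge0.
have kE : k.-1.+1 = k by rewrite prednK// (leq_ltn_trans _ ik).
have ik1 : (i <= k.-1)%N by rewrite -ltnS kE.
exists k.-1; rewrite kE; split=> //.
- apply: toh => //; rewrite leNgt; apply/negP => Wlt.
  have : P k.-1.
    rewrite /P Wlt orbT andbT ltn_neqAle ik1 andbT; apply/eqP => ik1E.
    by move: Wlt; rewrite -ik1E Wd ltNge divr_ge0.
  by move=> /kmin; rewrite -{1}kE ltnn.
- apply: toh => //; case/orP: Pk => [/eqP ->|Pk]; first by rewrite Wd divr_ge0.
  have : W i k + W k j <= W i j by apply: wD => //; apply: tau_mono => //; exact: ltnW.
  move: Pk; rewrite ltr_pdivrMr// ler_pdivlMr//; lra.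
Qed.

Lemma scheme_estimate s i j : (i <= j)%N -> grid_gauge s i j <= L ->
  `|remainder (grid_germ s) (grid_y s) (grid_m s) i j| <=
     K * ((grid_m s j - grid_m s i) * grid_gauge s i j + grid_gauge s i j ^+ 3) /\
  grid_m s j - grid_m s i <= (2 * C + 1) * grid_gauge s i j.
Proof.
have ti k : 0 <= tau s k by have /andP[] := tau_itv s k.
have tT k : tau s k <= T by have /andP[] := tau_itv s k.
move=> ij hL.
apply: (@controlled_small _ (grid_germ s) (grid_gauge s) (grid_y s) (grid_m s)
  C rho lam K L _ _ _ _ _ _ _ _ _ _ C_ge0 _ _ _ K_fix K_ge0 KL CL L_small
  i j ij hL).
- by move=> *; exact: h_ge0.
- by move=> *; apply: h_mono => //; exact: tau_mono.
- by move=> *; exact: control_halving.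
- by move=> *; exact: G_diag.
- by move=> *; apply: G_bound => //; exact: tau_mono.
- by move=> *; apply: G_almost_additive => //; exact: tau_mono.
- by move=> k; exact: scheme_y_ge0.
- by move=> k; exact: scheme_m_incr.
- by move=> k; exact: scheme_step.
- by move=> k; exact: scheme_contact.
- exact: rho_ge0.
- by rewrite le_max lexx.
- by rewrite le_max lexx orbT.
Qed.

Lemma increment_bound (dy dm g r H : R) : 0 <= dm -> 0 <= H -> H <= L ->
  dy = g + dm + r -> `|g| <= C * H -> dm <= (2 * C + 1) * H ->
  `|r| <= K * (dm * H + H ^+ 3) -> `|dy| <= (4 * C + 2) * H.
Proof.
move=> m0 H0 HL -> gH dmH rH.
have KH : K * H <= 1 / 2 by apply: le_trans KL; rewrite ler_wpM2l.
have L1 := L_small.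
have r2 : `|r| <= 1 / 2 * (dm + H ^+ 2).
  apply: (le_trans rH); rewrite [leLHS](_ : _ = K * H * (dm + H ^+ 2)); last by ring.
  by rewrite ler_wpM2r// addr_ge0// sqr_ge0.
have H2 : H ^+ 2 <= 1 / 4 * H by rewrite expr2 ler_wpM2r//; lra.
have := ler_normD (g + dm) r; have := ler_normD g dm; rewrite (ger0_norm m0); lra.
Qed.

Lemma scheme_increment s i j : (i <= j)%N -> grid_gauge s i j <= L ->
  `|grid_y s j - grid_y s i| <= (4 * C + 2) * grid_gauge s i j.
Proof.
move=> ij hL; have [rem dm] := scheme_estimate ij hL.
have /andP[i0 _] := tau_itv s i; have /andP[_ jT] := tau_itv s j.
apply: (@increment_bound _ _ (grid_germ s (grid_y s i) i j) _ _ _ _ hL _ _ dm rem).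
- by rewrite subr_ge0; exact: scheme_m_mono.
- exact: h_ge0.
- by rewrite /remainder; ring.
- apply: G_bound => //; first exact: tau_mono.
  have := L_small; move: hL; rewrite /grid_gauge; lra.
Qed.

Lemma scheme_m_const s i j : (i <= j)%N ->
  (forall k, (i < k)%N -> (k <= j)%N -> 0 < grid_y s k) -> grid_m s i = grid_m s j.
Proof.
elim: j => [|j IH]; first by rewrite leqn0 => /eqP ->.
rewrite leq_eqVlt => /predU1P[-> //|]; rewrite ltnS => ij pos.
rewrite IH//; last by move=> k ik kj; apply: pos => //; exact: leqW.
have := scheme_m_incr (grid_germ s) a j; rewrite le_eqVlt => /predU1P[//|/scheme_contact y0].
by have := pos j.+1 (leq_ltn_trans ij (ltnSn j)) (leqnn _); rewrite /grid_y y0 ltxx.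
Qed.

Definition approx_y s t := grid_y s (index t (grid s)).
Definition approx_m s t := grid_m s (index t (grid s)).

Lemma grid_estimate s u v : u \in grid s -> v \in grid s -> u <= v ->
  h u v <= L ->
  [/\ `|remainder G (approx_y s) (approx_m s) u v| <=
        K * ((approx_m s v - approx_m s u) * h u v + h u v ^+ 3),
      approx_m s v - approx_m s u <= (2 * C + 1) * h u v &
      `|approx_y s v - approx_y s u| <= (4 * C + 2) * h u v].
Proof.
move=> us vs uv hL; have ij := index_grid_mono us vs uv.
have hE : grid_gauge s (index u (grid s)) (index v (grid s)) = h u v.
  by rewrite /grid_gauge !tau_index.
have := @scheme_estimate s _ _ ij; have := @scheme_increment s _ _ ij.
by rewrite /remainder /grid_germ !hE !tau_index// => /(_ hL) ? /(_ hL)[].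
Qed.

Let C1_ge0 : 0 <= 4 * C + 2. Proof. by rewrite addr_ge0// mulr_ge0. Qed.

(** Chaining the local increments over steps of fixed length [d / 2]: the bound
does not depend on the list [s], which only has to contain the chain. *)
Lemma partition_bound : exists B, forall t, 0 <= t -> t <= T ->
  refinement [set s | approx_y s t \in `[0, B] /\ approx_m s t \in `[0, B]].
Proof.
have [d d0 hd] := gauge_small p_gt0 w_control L_gt0.
pose b := (4 * C + 2) * L.
have b0 : 0 <= b by rewrite mulr_ge0// ltW.
have main n t : 0 <= t -> t <= T -> t <= n%:R * (d / 2) ->
    refinement [set s | approx_y s t <= a + n%:R * b /\ approx_m s t <= a + n%:R * b].
  elim: n t => [|n IH] t t0 tT tn.
    have -> : t = 0 by apply/eqP; rewrite eq_le t0 andbT (le_trans tn)// mul0r.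
    apply: (@filterE _ _ (refinement_filter _)) => s /=.
    by rewrite /approx_y /approx_m index_zero_grid /= mul0r addr0 lexx.
  pose t' := Num.max 0 (t - d / 2).
  have t'0 : 0 <= t' by rewrite le_max lexx.
  have t't : t' <= t by rewrite ge_max t0/= gerBl divr_ge0// ltW.
  have t'n : t' <= n%:R * (d / 2).
    rewrite ge_max mulr_ge0//= ?divr_ge0 ?(ltW d0)//.
    move: tn; rewrite -natr1; lra.
  have htt : h t' t <= L.
    apply: hd => //; rewrite ltrBlDl -ltrBlDr lt_max; apply/orP; right; lra.
  have FF := refinement_filter R.
  apply: filterS3 (refinement_mem t) (refinement_mem t') (IH _ t'0 (le_trans t't tT) t'n).
  move=> s /= ts t's [yt mt].
  have gt : t \in grid s by rewrite mem_grid ts in_itv/= t0 tT orbT.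
  have gt' : t' \in grid s by rewrite mem_grid t's in_itv/= t'0 (le_trans t't tT) orbT.
  have [_ dm dy] := grid_estimate gt' gt t't htt.
  have hb : (4 * C + 2) * h t' t <= b by rewrite ler_wpM2l.
  have hc : 0 <= C * h t' t by rewrite mulr_ge0.
  have := h_ge0 t' t; have := ler_norm (approx_y s t - approx_y s t').
  rewrite -natr1 mulrDl mul1r; split; lra.
have [n nT] : exists n : nat, T <= n%:R * (d / 2).
  have d2 : 0 < d / 2 by rewrite divr_gt0.
  exists (Num.bound (T / (d / 2))); rewrite -ler_pdivrMr//.
  by apply/ltW/archi_boundP; rewrite divr_ge0// ltW.
exists (a + n%:R * b) => t t0 tT.
have FF := refinement_filter R.
apply: filterS (main n t t0 tT (le_trans tT nT)) => s [ys ms] /=.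
rewrite !in_itv/= ys ms !andbT; split; first exact: scheme_y_ge0.
by have := scheme_m_mono (grid_germ s) a (leq0n (index t (grid s))).
Qed.

(** Existence for an abstract almost additive germ.  The equation is the bound on
[remainder], which is of higher order than the germ; [y dm = 0] appears as the
local constancy of [m] where [y] is positive, a form that survives pointwise
limits. *)
Lemma reflected_solution : exists y m : R -> R,
  [/\ y 0 = a /\ m 0 = 0,
      forall t, 0 <= t -> t <= T -> 0 <= y t,
      forall s t, 0 <= s -> s <= t -> t <= T -> m s <= m t,
      exists B, forall t, 0 <= t -> t <= T -> y t <= B /\ m t <= B &
      (exists2 A, 0 <= A & exists2 l, 0 < l &
        forall s t, 0 <= s -> s <= t -> t <= T -> h s t <= l ->
        [/\ `|remainder G y m s t| <= A * ((m t - m s) * h s t + h s t ^+ 3),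
            m t - m s <= A * h s t & `|y t - y s| <= A * h s t]) /\
      forall v, 0 <= v -> v <= T -> 0 < y v -> exists2 d, 0 < d &
        forall s t, 0 <= s -> s <= t -> t <= T -> `|s - v| < d -> `|t - v| < d ->
          m s = m t].
Proof.
have [U [UU FU]] := ultraFilterLemma (refinement_filter R).
have PU := ultra_proper.
have [B bounded] := partition_bound.
pose y t := lim (approx_y ^~ t @ U); pose m t := lim (approx_m ^~ t @ U).
have ycvg t : 0 <= t -> t <= T -> approx_y ^~ t @ U --> y t.
  move=> t0 tT; apply: (ultra_bounded_cvg (b := 0) (c := B)) => //.
  by apply: filterS (FU _ (bounded t t0 tT)) => s [].
have mcvg t : 0 <= t -> t <= T -> approx_m ^~ t @ U --> m t.
  move=> t0 tT; apply: (ultra_bounded_cvg (b := 0) (c := B)) => //.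
  by apply: filterS (FU _ (bounded t t0 tT)) => s [].
have ongrid t : 0 <= t -> t <= T -> U [set s | t \in grid s].
  move=> t0 tT; apply: filterS (FU _ (refinement_mem t)) => s /= ts.
  by rewrite mem_grid ts in_itv/= t0 tT orbT.
have lim_le (f g : seq R -> R) k l : f @ U --> k -> g @ U --> l ->
    U [set s | f s <= g s] -> k <= l.
  move=> fk gl fg; rewrite -subr_ge0; apply: cvgr_to_ge (cvgB gl fk) _.
  by apply: filterS fg => r /=; rewrite subr_ge0.
exists y, m; split.
- have atzero (c : R) (F : seq R -> R) : (forall s, F s = c) -> lim (F @ U) = c.
    by move=> Fc; rewrite (_ : F = cst c) ?lim_cst//; exact/funext.
  by split; apply: atzero => s; rewrite /approx_y /approx_m index_zero_grid.
- move=> t t0 tT; apply: (lim_le (cst 0) (approx_y ^~ t)) (ycvg t t0 tT) _; first exact: cvg_cst.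
  by apply: filterE => s; exact: scheme_y_ge0.
- move=> s t s0 st tT; have sT := le_trans st tT; have t0 := le_trans s0 st.
  apply: lim_le (mcvg s s0 sT) (mcvg t t0 tT) _.
  apply: filterS2 (ongrid s s0 sT) (ongrid t t0 tT) => r sr tr.
  exact/scheme_m_mono/index_grid_mono.
- exists B => t t0 tT; split.
    apply: (lim_le (approx_y ^~ t) (cst B)) (ycvg t t0 tT) (cvg_cst _) _.
    by apply: filterS (FU _ (bounded t t0 tT)) => s []/=; rewrite in_itv/= => /andP[].
  apply: (lim_le (approx_m ^~ t) (cst B)) (mcvg t t0 tT) (cvg_cst _) _.
  by apply: filterS (FU _ (bounded t t0 tT)) => s [_]/=; rewrite in_itv/= => /andP[].
- split.
    pose A := K + (4 * C + 2).
    exists A; first by rewrite addr_ge0.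
    exists L => // s t s0 st tT hL; have sT := le_trans st tT; have t0 := le_trans s0 st.
    have h0 := h_ge0 s t.
    have dy : (fun r => approx_y r t - approx_y r s) @ U --> y t - y s.
      by apply: cvgB; [exact: ycvg|exact: ycvg].
    have dm : (fun r => approx_m r t - approx_m r s) @ U --> m t - m s.
      by apply: cvgB; [exact: mcvg|exact: mcvg].
    have Gc : (fun r => G (approx_y r s) s t) @ U --> G (y s) s t.
      by apply: (cvg_comp (approx_y ^~ s) (fun x => G x s t) (ycvg s s0 sT)); exact: G_cont.
    have est : U [set r | [/\ `|remainder G (approx_y r) (approx_m r) s t| <=
        K * ((approx_m r t - approx_m r s) * h s t + h s t ^+ 3),
        approx_m r t - approx_m r s <= (2 * C + 1) * h s t &
        `|approx_y r t - approx_y r s| <= (4 * C + 2) * h s t]].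
      apply: filterS2 (ongrid s s0 sT) (ongrid t t0 tT) => r sr tr.
      exact: grid_estimate.
    have dm0 : 0 <= m t - m s.
      apply: lim_le (cvg_cst _) dm _.
      apply: filterS2 (ongrid s s0 sT) (ongrid t t0 tT) => r sr tr /=; rewrite subr_ge0.
      exact/scheme_m_mono/index_grid_mono.
    have c2 : 0 <= C * h s t by rewrite mulr_ge0.
    have k2 : 0 <= K * h s t by rewrite mulr_ge0.
    split.
    - apply: (@le_trans _ _ (K * ((m t - m s) * h s t + h s t ^+ 3))); last first.
        apply: ler_wpM2r; last by rewrite lerDl.
        by rewrite addr_ge0 ?mulr_ge0 ?exprn_ge0.
      apply: (lim_le (fun r => `|remainder G (approx_y r) (approx_m r) s t|)
        (fun r => K * ((approx_m r t - approx_m r s) * h s t + h s t ^+ 3))).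
      + by apply: cvg_norm; apply: cvgB => //; exact: cvgB.
      + by apply: cvgMr; apply: cvgD; [exact: cvgMl|exact: cvg_cst].
      + by apply: filterS est => r [].
    - apply: (@le_trans _ _ ((2 * C + 1) * h s t)); last by rewrite /A; lra.
      by apply: lim_le dm (cvg_cst _) _; apply: filterS est => r [].
    - apply: (@le_trans _ _ ((4 * C + 2) * h s t)); last by rewrite /A; lra.
      by apply: lim_le (cvg_norm dy) (cvg_cst _) _; apply: filterS est => r [].
  (* Near [v], the approximations stay within [y v / 4] of their value at [v],
     which eventually exceeds [y v / 2]. *)
  move=> v v0 vT yv.
  pose e := Num.min L (y v / 4 / (4 * C + 2)).
  have C1 : 0 < 4 * C + 2 by have := C_ge0; lra.
  have e0 : 0 < e by rewrite lt_min L_gt0/= !divr_gt0.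
  have [d d0 hd] := gauge_small p_gt0 w_control e0; exists d => // s t s0 st tT sv tv.
  have sT := le_trans st tT; have t0 := le_trans s0 st.
  have near_v r k l : (k <= l)%N -> tau r l - tau r k < d ->
      `|grid_y r l - grid_y r k| <= y v / 4.
    move=> kl kld; have /andP[k0 _] := tau_itv r k; have /andP[_ lT] := tau_itv r l.
    have := hd _ _ k0 (tau_mono r kl) lT kld; rewrite le_min => /andP[hL he].
    apply: (le_trans (scheme_increment kl hL)).
    by move: he; rewrite ler_pdivlMr// mulrC.
  have mE : U [set r | approx_m r s = approx_m r t].
    have vy : U [set r | v \in grid r /\ y v / 2 < approx_y r v].
      have yv2 : y v / 2 < y v by lra.
      have y2 : U [set r | y v / 2 < approx_y r v] by exact: cvgr_gt (ycvg v v0 vT) _ yv2.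
      by apply: filterS2 (ongrid v v0 vT) y2 => r.
    apply: filterS3 (ongrid s s0 sT) (ongrid t t0 tT) vy => r sr tr [vr yr].
    apply: scheme_m_const.
      exact: index_grid_mono.
    move=> k sk kt; have := tau_mono r (ltnW sk); have := tau_mono r kt.
    rewrite !tau_index// => tk ks.
    have [kv|/ltnW vk] := leqP k (index v (grid r)).
      have := near_v r _ _ kv; rewrite tau_index// -/(approx_y r v) => H.
      have : v - tau r k < d by move: sv; rewrite ltr_norml; lra.
      move=> /H; rewrite ler_norml; lra.
    have := near_v r _ _ vk; rewrite tau_index// -/(approx_y r v) => H.
    have : tau r k - v < d by move: tv; rewrite ltr_norml; lra.
    move=> /H; rewrite ler_norml; lra.
  apply/eqP; rewrite eq_le; apply/andP; split.
    by apply: lim_le (mcvg s s0 sT) (mcvg t t0 tT) _; apply: filterS mE => r /= ->.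
  by apply: lim_le (mcvg t t0 tT) (mcvg s s0 sT) _; apply: filterS mE => r /= ->.
Qed.

End Reflected.

(** * The reflection measure *)

Section ContactMeasure.
Variable R : realType.

Lemma stieltjes_measure (F : R -> R) : {homo F : x y / x <= y} -> continuous F ->
  exists mu : {measure set (measurableTypeR R) -> \bar R},
    forall a b, a <= b -> mu `]a, b]%classic = (F b - F a)%:E.
Proof.
move=> nd cF.
pose f : cumulative R R := HB.pack F (isCumulative.Build R _ R F nd (right_continuousW cF)).
exists (lebesgue_stieltjes_measure f) => a b ab.
rewrite /= /lebesgue_stieltjes_measure /measure_extension measurable_mu_extE /=;
  last exact: is_ocitv.
by rewrite wlength_itv_bnd.
Qed.

Variable T : R.
Hypothesis T_ge0 : 0 <= T.

(** Extends paths on [[0, T]] to the line by constants, so that Stieltjes measures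
and measurability on the line apply. *)
Definition clamp (t : R) := Num.max 0 (Num.min t T).

Lemma clamp_itv t : 0 <= clamp t <= T.
Proof. by rewrite /clamp le_max lexx/= ge_max T_ge0 ge_min lexx orbT. Qed.

Lemma clamp_id t : 0 <= t -> t <= T -> clamp t = t.
Proof. by move=> t0 tT; rewrite /clamp min_l// max_r. Qed.

Lemma clamp_mono s t : s <= t -> clamp s <= clamp t.
Proof.
move=> st; rewrite /clamp ge_max !le_max lexx /=; apply/orP; right.
by rewrite le_min !ge_min st lexx orbT.
Qed.

Lemma clamp_lipschitz s t : s <= t -> clamp t - clamp s <= t - s.
Proof.
move=> st; rewrite /clamp; have T0 := T_ge0.
by case: (ltP t T) => ?; case: (ltP s T) => ?; case: (ltP 0 t) => ?;
  case: (ltP 0 s) => ?; case: (ltP 0 T) => ?; lra.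
Qed.

Definition equicont (g : R -> R) := forall e, 0 < e -> exists2 d, 0 < d &
  forall s t, 0 <= s -> s <= t -> t <= T -> t - s < d -> `|g t - g s| <= e.

Lemma clamp_continuous g : equicont g -> continuous (g \o clamp).
Proof.
move=> gc x; apply/cvgrPdist_le => e e0; have [d d0 gd] := gc e e0.
near=> t; have xt : `|x - t| < d by near: t; exact: cvgr_dist_lt.
have [xt'|/ltW tx] := leP x t.
  have /andP[a0 _] := clamp_itv x; have /andP[_ b0] := clamp_itv t.
  rewrite distrC; apply: gd => //; first exact: clamp_mono.
  apply: le_lt_trans (clamp_lipschitz xt') _.
  by rewrite -[ltLHS]ger0_norm ?subr_ge0// distrC.
have /andP[a0 _] := clamp_itv t; have /andP[_ b0] := clamp_itv x.
apply: gd => //; first exact: clamp_mono.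
apply: le_lt_trans (clamp_lipschitz tx) _.
by rewrite -[ltLHS]ger0_norm ?subr_ge0.
Unshelve. all: by end_near. Qed.

(** Every point where [y] is positive lies in an interval with rational ends on
which [m] is constant; there are countably many such intervals, and each is
null. *)
Lemma contact_measure (y m : R -> R) : m 0 = 0 ->
  (forall s t, 0 <= s -> s <= t -> t <= T -> m s <= m t) ->
  (forall t, 0 <= t -> t <= T -> 0 <= y t) ->
  equicont y -> equicont m ->
  (forall v, 0 <= v -> v <= T -> 0 < y v -> exists2 d, 0 < d &
     forall s t, 0 <= s -> s <= t -> t <= T -> `|s - v| < d -> `|t - v| < d ->
       m s = m t) ->
  exists2 mu : {measure set (measurableTypeR R) -> \bar R},
    (forall t, 0 <= t <= T -> mu `[0, t]%classic = (m t)%:E) &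
    (forall t, 0 <= t <= T ->
       (m t)%:E = (\int[mu]_(u in `[0%R, t]) (\1_[set v | y v = 0%R] u)%:E)%E).
Proof.
move=> m0 m_nd y0 yc mc contact.
pose m' := m \o clamp; pose y' := y \o clamp.
have m'_nd : {homo m' : s t / s <= t}.
  move=> s t st; have /andP[a0 _] := clamp_itv s; have /andP[_ b0] := clamp_itv t.
  by apply: m_nd => //; exact: clamp_mono.
(* [m 0 = 0]: the extension has no jump at 0, and [mu] has no atom there. *)
have [mu muE] := stieltjes_measure m'_nd (clamp_continuous mc).
have mitv (i : interval R) : measurable ([set` i] : set (measurableTypeR R)).
  exact: measurable_itv.
have mu0t t : 0 <= t <= T -> mu `[0, t]%classic = (m t)%:E.
  move=> /andP[t0 tT].
  have N1 : -1 <= 0 :> R by lra.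
  have m'N1 : m' (-1) = 0 by rewrite /m' /= /clamp min_l ?max_l// (le_trans N1).
  have m'0 : m' 0 = 0 by rewrite /m' /= clamp_id.
  have m't : m' t = m t by rewrite /m' /= clamp_id.
  have null : mu `]-1, 0[%classic = 0%E.
    apply/eqP; rewrite -measure_le0 -(_ : mu `]-1, 0]%classic = 0%E).
      apply: le_measure; rewrite ?inE//; apply: subset_itvl; by rewrite bnd_simp.
    by rewrite muE// m'N1 m'0 subrr.
  have : mu `]-1, t]%classic = (m t)%:E by rewrite muE ?m'N1 ?subr0 ?m't//; lra.
  rewrite (_ : `]-1, t]%classic = `]-1, 0[%classic `|` `[0, t]%classic); last first.
    by rewrite -itv_bndbnd_setU// bnd_simp//; lra.
  have disj : `]-1, 0[%classic `&` `[0, t]%classic = set0 :> set R.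
    rewrite -subset0 => x [] /=; rewrite !in_itv/= => /andP[_ x0] /andP[].
    by move=> /(lt_le_trans x0); rewrite ltxx.
  by rewrite (measureU mu (mitv _) (mitv _) disj) [X in (X + _)%E]null add0e.
exists mu => // t tT.
pose F n := if unpickle n is Some (q1, q2) then
  if (ratr q1 <= ratr q2 :> R) && (m' (ratr q1) == m' (ratr q2))
  then `]ratr q1, ratr q2]%classic else set0 else set0 : set (measurableTypeR R).
have Fnull n : mu.-negligible (F n).
  rewrite /F; case: unpickle => [[q1 q2]|]; last exact: negligible_set0.
  case: ifPn => [/andP[q12 /eqP mq]|_]; last exact: negligible_set0.
  apply/negligibleP; first exact: mitv.
  by apply: (etrans (muE _ _ q12)); rewrite mq subrr.
have cover : [set v | y' v <> 0] `<=` \bigcup_n F n.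
  move=> v /= /eqP yv; have /andP[a0 aT] := clamp_itv v.
  have yv0 : 0 < y (clamp v) by rewrite lt_neqAle eq_sym yv/= y0.
  have [d d0 H] := contact _ a0 aT yv0.
  have [q1] : exists q, ratr q \in `]v - d, v[ by apply: rat_in_itvoo; rewrite gtrBl.
  rewrite in_itv/= => /andP[dq1 q1v].
  have [q2] : exists q, ratr q \in `]v, v + d[ by apply: rat_in_itvoo; rewrite ltrDl.
  rewrite in_itv/= => /andP[vq2 q2d].
  exists (pickle (q1, q2)); [exact: I|rewrite /F pickleK].
  have q12 : ratr q1 <= ratr q2 :> R by rewrite (le_trans (ltW q1v))// ltW.
  have /andP[c0 cT] := clamp_itv (ratr q1); have /andP[e0 eT] := clamp_itv (ratr q2).
  have c1 := clamp_lipschitz (ltW q1v); have c2 := clamp_lipschitz (ltW vq2).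
  have c3 := clamp_mono (ltW q1v); have c4 := clamp_mono (ltW vq2).
  rewrite q12 /= /m' /= (H (clamp (ratr q1)) (clamp (ratr q2))) ?eqxx//=.
  - by rewrite in_itv/= q1v ltW.
  - exact: clamp_mono.
  - by rewrite ler0_norm ?subr_le0//; lra.
  - by rewrite ger0_norm ?subr_ge0//; lra.
have mZ : measurable ([set v | y' v = 0] : set (measurableTypeR R)).
  have mf : measurable_fun setT y'.
    by apply: continuous_measurable_fun; exact: clamp_continuous.
  by have := mf measurableT _ (measurable_set1 (0 : R)); rewrite setTI.
pose Z : set (measurableTypeR R) := [set v | y' v = 0].
transitivity (\int[mu]_(u in `[0%R, t]) (\1_Z u)%:E)%E; last first.
  apply: eq_integral => u; rewrite inE/= in_itv/= => /andP[u0 ut].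
  have uT : u <= T by case/andP: tT => _; exact: le_trans.
  rewrite !indicE; congr (nat_of_bool _)%:R%:E.
  by apply/idP/idP; rewrite !inE /Z /y' /= clamp_id.
rewrite integral_indic// -mu0t//.
have mI : measurable (`[0, t]%classic : set (measurableTypeR R)) by exact: mitv.
rewrite (measureDI mu mI mZ) setIC [X in (X + _)%E](_ : _ = 0%E) ?add0e//.
apply: measure_negligible; first exact: measurableD.
apply: negligibleS (negligible_bigcup Fnull).
by move=> v [_ Zv]; exact: cover.
Qed.

End ContactMeasure.

(** * The rough driver and the existence theorem *)

Section RoughPath.
Variables (R : realType) (N : nat) (p T : R).
Variables (X1 : R -> R -> 'rV[R]_N) (X2 : R -> R -> 'M[R]_N).

Lemma rough_path_control : 0 < p -> rough_path p T X1 X2 ->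
  exists2 w, control 0 T w & forall s t, 0 <= s -> s < t -> t <= T ->
    `|X1 s t| <= gauge p w s t /\ `|X2 s t| <= gauge p w s t ^+ 2.
Proof.
move=> p0 [v1 v2 _]; have p2 : 0 < p / 2 by rewrite divr_gt0.
have [w1 c1 b1] := in_V2_control p0 v1; have [w2 c2 b2] := in_V2_control p2 v2.
exists (fun s t => w1 s t + w2 s t); first exact: controlD.
move=> s t s0 st tT.
have [w10 _ _] := c1; have [w20 _ _] := c2.
have p1' := w10 s t s0 (ltW st) tT; have p2' := w20 s t s0 (ltW st) tT.
have root q x v : 0 < q -> 0 <= x -> x `^ q <= v -> x <= v `^ q^-1.
  move=> q0 x0 xv; rewrite -[x](_ : (x `^ q) `^ q^-1 = x).
    apply: ge0_ler_powR; rewrite ?invr_ge0 ?(ltW q0) ?nnegrE ?powR_ge0//.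
    by rewrite (le_trans _ xv) ?powR_ge0.
  by rewrite -powRrM mulfV ?gt_eqF// powRr1.
rewrite /gauge; split.
  by apply: root => //; apply: (le_trans (b1 s t s0 st tT)); rewrite lerDl.
rewrite /gauge -powR_mulrn ?powR_ge0// -powRrM.
rewrite (_ : p^-1 * 2 = (p / 2)^-1); last by rewrite invfM invrK.
by apply: root => //; apply: (le_trans (b2 s t s0 st tT)); rewrite lerDr.
Qed.

(** Variation sums do not see the diagonal, so the hypotheses leave [X s s]
arbitrary.  Setting it to 0 makes Chen's relation hold for [s <= u <= t]. *)
Definition offdiag (E : nmodType) (X : R -> R -> E) (s t : R) : E :=
  if s == t then 0 else X s t.

Lemma offdiag_chen s u t : rough_path p T X1 X2 ->
  0 <= s -> s <= u -> u <= t -> t <= T ->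
  offdiag X1 s t = offdiag X1 s u + offdiag X1 u t /\
  offdiag X2 s t = offdiag X2 s u + offdiag X2 u t +
    (offdiag X1 s u)^T *m offdiag X1 u t.
Proof.
move=> [_ _ chen] s0 su ut tT; rewrite /offdiag.
have [<-|nsu] := eqVneq s u; first by rewrite !add0r trmx0 mul0mx addr0.
have [ute|nut] := eqVneq u t; first by rewrite -ute (negbTE nsu) !addr0 mulmx0 addr0.
have lsu : s < u by rewrite lt_neqAle nsu.
have lut : u < t by rewrite lt_neqAle nut.
rewrite lt_eqF ?(lt_trans lsu)//; have [c1 c2] := chen s u t s0 lsu lut tT.
split.
  by move/eqP: c1; rewrite /incr2 subr_eq0 subr_eq => /eqP ->; rewrite addrC.
apply/matrixP => i j; have := c2 i j; rewrite /incr2 !mxE big_ord1 !mxE => <-.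
ring.
Qed.

End RoughPath.

Unset Implicit Arguments.

Theorem theorem6 (R : realType) (T a p : R) (N : nat)
    (f : R -> 'rV[R]_N) (X1 : R -> R -> 'rV[R]_N) (X2 : R -> R -> 'M[R]_N)
    (hT : 0 < T) (ha : 0 < a) (hN : (1 <= N)%N) (hp : 2 <= p < 3)
    (hf : C2b f) (hX : geometric_rough_path p T X1 X2) :
  exists y m : R -> R, reflected_rde_solution p T a f X1 X2 y m.
Proof.
have [rX _] := hX; have [p2 p3] := andP hp; have p0 : 0 < p by lra.
have T0 := ltW hT.
have [w cw wX] := rough_path_control p0 rX.
have [C C0 [gN gB gA]] := germ_estimates hf.
pose Z1 := offdiag X1; pose Z2 := offdiag X2.
pose h := gauge p w; have h0 s t : 0 <= h s t by exact: powR_ge0.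
have Zb s t : 0 <= s -> s <= t -> t <= T ->
    `|Z1 s t| <= h s t /\ `|Z2 s t| <= h s t ^+ 2.
  move=> s0 st tT; rewrite /Z1 /Z2 /offdiag; case: eqVneq => [_|nst].
    by rewrite !normr0 sqr_ge0.
  by apply: wX => //; rewrite lt_neqAle nst.
have h_mono s s' t' t : 0 <= s -> s <= s' -> s' <= t' -> t' <= t -> t <= T ->
    h s' t' <= h s t.
  exact: gauge_mono p0 cw.
pose G xi s t := germ f xi (Z1 s t) (Z2 s t).
have Gd x t : G x t t = 0 by rewrite /G /Z1 /Z2 /offdiag eqxx germ00.
have Gb x s t : 0 <= s -> s <= t -> t <= T -> h s t <= 1 -> `|G x s t| <= C * h s t.
  by move=> s0 st tT h1; have [z1 z2] := Zb s t s0 st tT; exact: gB.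
have Ga x x' s u t : 0 <= s -> s <= u -> u <= t -> t <= T -> h s t <= 1 ->
    `|x' - x - G x s u| <= 1 ->
    `|G x s t - G x s u - G x' u t| <= C * (h s t ^+ 3 + `|x' - x - G x s u| * h s t).
  move=> s0 su ut tT h1; have u0 := le_trans s0 su; have uT := le_trans ut tT.
  have [z1 z2] := Zb s u s0 su uT; have [z1' z2'] := Zb u t u0 ut tT.
  have hsu : h s u <= h s t by exact: h_mono.
  have hut : h u t <= h s t by exact: h_mono.
  have sq k : 0 <= k -> k <= h s t -> k ^+ 2 <= h s t ^+ 2.
    by move=> k0 kh; rewrite lerXn2r// nnegrE.
  have [c1 c2] := offdiag_chen rX s0 su ut tT.
  rewrite /G /Z1 /Z2 c1 c2; apply: gA => //.
  - exact: le_trans z1 hsu.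
  - exact: le_trans z2 (sq _ _ hsu).
  - exact: le_trans z1' hut.
  - exact: le_trans z2' (sq _ _ hut).
have Gc s t : continuous (fun x => G x s t) by exact: germ_continuous.
have [y [m [[y0 m0] y_ge0 m_nd [B yB] [[A A0 [l l0 loc]] contact]]]] :=
  reflected_solution T0 C0 (ltW ha) p0 p3 cw Gd Gb Ga Gc.
have m_ge0 t : 0 <= t -> t <= T -> 0 <= m t.
  by move=> t0 tT; rewrite -m0; apply: m_nd.
have B0 : 0 <= B by apply: le_trans (y_ge0 0 (lexx _) T0) _; have [] := yB 0 (lexx _) T0.
pose D := A + B / l.
have D0 : 0 <= D by rewrite addr_ge0// divr_ge0// ltW.
have yD s t : 0 <= s -> s <= t -> t <= T -> `|y t - y s| <= D * h s t.
  move=> s0 st tT; have sT := le_trans st tT; have t0 := le_trans s0 st.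
  have := @local_to_global _ A B l (y t - y s) (h s t) 1 A0 B0 l0 (h0 s t); rewrite !expr1; apply.
    have := y_ge0 s s0 sT; have := y_ge0 t t0 tT.
    have [] := yB s s0 sT; have [] := yB t t0 tT; rewrite ler_norml; lra.
  by move=> hl; have [] := loc s t s0 st tT hl.
have mD s t : 0 <= s -> s <= t -> t <= T -> `|m t - m s| <= D * h s t.
  move=> s0 st tT; have sT := le_trans st tT; have t0 := le_trans s0 st.
  have := @local_to_global _ A B l (m t - m s) (h s t) 1 A0 B0 l0 (h0 s t); rewrite !expr1; apply.
    have := m_ge0 s s0 sT; have := m_ge0 t t0 tT.
    have [] := yB s s0 sT; have [] := yB t t0 tT; rewrite ler_norml; lra.
  move=> hl; have [_ ? _] := loc s t s0 st tT hl.
  by rewrite ger0_norm// subr_ge0 m_nd.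
have equi g : (forall s t, 0 <= s -> s <= t -> t <= T -> `|g t - g s| <= D * h s t) ->
    equicont T g.
  move=> gD e e0; have D1 : 0 < D + 1 by lra.
  have [d d0 hd] := gauge_small p0 cw (divr_gt0 e0 D1).
  exists d => // s t s0 st tT std; apply: (le_trans (gD s t s0 st tT)).
  have := hd s t s0 st tT std; rewrite -/h ler_pdivlMr// mulrDr mulr1 mulrC.
  by have := h0 s t; lra.
have cm := monotone_control m_nd (equi m mD).
exists y, m; split.
- split; last by move=> t /andP[]; exact: y_ge0.
  apply: (gauge_in_V2 p0 D0 cw) => s t s0 st tT.
  by apply: yD => //; exact: ltW.
- split=> [|t /andP[]|]//; last exact: m_ge0.
  apply: (control_in_V2 ltr01 cm) => s t s0 st tT.
  by rewrite powRr1// ger0_norm// subr_ge0 m_nd// ltW.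
- pose germX s t := \sum_(i < N) f (y s) 0 i * X1 s t 0 i +
     \sum_(i < N) \sum_(j < N) f2 f i j (y s) * X2 s t j i.
  exists (fun s t => incr y s t - germX s t - incr m s t); last first.
    by move=> s t _ _ _; rewrite -/(germX s t); ring.
  have ynE s t : s < t -> incr y s t - germX s t - incr m s t = remainder G y m s t.
    by move=> st; rewrite /remainder /G germE /Z1 /Z2 /offdiag lt_eqF.
  (* The remainder is small enough at all scales: the covering is [[0, T]] alone. *)
  exists (fun=> `[0, T]%classic); split=> [k||k].
  - exact: interval_is_interval.
  - by rewrite bigcup_const//; exists 0%N.
  pose c s t := (m t - m s) + w s t; have cc : control 0 T c by exact: controlD.
  pose g := gauge p c; have g0 s t : 0 <= g s t by exact: powR_ge0.
  have c0 s t : 0 <= s -> s <= t -> t <= T -> 0 <= c s t.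
    by have [+ _ _] := cc; exact.
  have hg s t : 0 <= s -> s <= t -> t <= T -> h s t <= g s t.
    move=> s0 st tT; have w0 : 0 <= w s t by have [+ _ _] := cw; exact.
    apply: ge0_ler_powR; rewrite ?invr_ge0 ?(ltW p0)// ?nnegrE ?c0//.
    by rewrite /c lerDr subr_ge0 m_nd.
  pose Gam := g 0 T `^ (p - 2); have Gam0 : 0 <= Gam by exact: powR_ge0.
  pose H := h 0 T; have H0 : 0 <= H by exact: h0.
  (* A crude bound on the remainder, for the large scales. *)
  pose E := 2 * B + C * (H + H ^+ 2).
  have E0 : 0 <= E by rewrite addr_ge0 ?mulr_ge0// addr_ge0// sqr_ge0.
  have p3_gt0 : 0 < p / 3 by rewrite divr_gt0.
  have AG : 0 <= A * (Gam + 1) by rewrite mulr_ge0// addr_ge0.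
  pose K := A * (Gam + 1) + E / l ^+ 3.
  have K0 : 0 <= K by rewrite addr_ge0// divr_ge0// exprn_ge0// ltW.
  apply: (gauge_in_V2 p3_gt0 K0 cc) => s t s0 /[dup] lst /ltW st tT.
  have sT := le_trans st tT; have t0 := le_trans s0 st.
  have -> : gauge (p / 3) c s t = g s t ^+ 3.
    by rewrite /g /gauge -powR_mulrn ?powR_ge0// -powRrM invfM invrK.
  have hg3 : h s t ^+ 3 <= g s t ^+ 3 by rewrite lerXn2r ?nnegrE// hg.
  rewrite ynE//; apply: local_to_global => //; last first.
    move=> gl; have hl := le_trans (hg s t s0 st tT) gl.
    have [rem _ _] := loc s t s0 st tT hl; apply: (le_trans rem).
    rewrite -mulrA ler_wpM2l// [leRHS]mulrDl mul1r lerD//.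
    exact: (control_mul_gauge p2 cm cw s0 st tT).
  have Gs : `|G (y s) s t| <= C * (H + H ^+ 2).
    apply: (le_trans (gN _ _ _)); apply: ler_wpM2l => //.
    have [z1 z2] := Zb s t s0 st tT; have hH : h s t <= H by exact: h_mono.
    apply: lerD; first exact: le_trans hH.
    by apply: (le_trans z2); rewrite lerXn2r// nnegrE.
  have := y_ge0 s s0 sT; have := y_ge0 t t0 tT; have := m_nd s t s0 st tT.
  have := m_ge0 s s0 sT; have [ys ms] := yB s s0 sT; have [yt mt] := yB t t0 tT.
  rewrite /remainder /E; move: Gs; rewrite !ler_norml; lra.
- exact: y0.
- exact: (contact_measure T0 m0 m_nd y_ge0 (equi y yD) (equi m mD) contact).
Qed.
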